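(* Let $\Omega=(a,b)$ be a finite open interval, $\alpha>0$ and $1\le p<\infty$. For each $\Omega'\subset\subset\Omega$ there exist a compact set $K\subset\Omega$, a constant $C=C(\alpha,p,K)>0$ and a mapping $E:{}^{\pm}W^{\alpha,p}(\Omega)\to{}^{\pm}W^{\alpha,p}(\mathbb{R})$ such that for every $u\in{}^{\pm}W^{\alpha,p}(\Omega)$: (i) $Eu=u$ a.e. in $\Omega'$; (ii) $\operatorname{supp}(Eu)\subseteq K$; (iii) $\|Eu\|_{{}^{\pm}W^{\alpha,p}(\mathbb{R})}\le C\|u\|_{{}^{\pm}W^{\alpha,p}(\Omega)}$. (This holds for each of the signs $-$ and $+$.)
   Context: $\Omega'\subset\subset\Omega$ means $\overline{\Omega'}$ is a compact subset of $\Omega$. For $\alpha>0$ let $[\alpha]$ be its integer part and $n=[\alpha]+1$. For $\varphi\in C_0^\infty(\mathbb{R})$: ${}^{-}D^{\alpha}\varphi(x)=\frac{1}{\Gamma(n-\alpha)}\frac{d^n}{dx^n}\int_{-\infty}^x\frac{\varphi(y)}{(x-y)^{\alpha-n+1}}dy$ and ${}^{+}D^{\alpha}\varphi(x)=\frac{(-1)^n}{\Gamma(n-\alpha)}\frac{d^n}{dx^n}\int_x^{\infty}\frac{\varphi(y)}{(y-x)^{\alpha-n+1}}dy$. For $U=\Omega$ or $U=\mathbb{R}$, and $u\in L^1(U)$ (or, with the same identity, $u\in L^p(U)$), $v\in L^1_{loc}(U)$ is the left (resp. right) weak fractional derivative of $u$ on $U$, $v={}^{-}\mathcal{D}^{\alpha}u$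 (resp. ${}^{+}\mathcal{D}^{\alpha}u$), if $\int_U v\varphi\,dx=(-1)^{[\alpha]}\int_U u\,{}^{+}D^{\alpha}\tilde\varphi\,dx$ (resp. with ${}^{-}D^{\alpha}\tilde\varphi$) for all $\varphi\in C_0^\infty(U)$, where $\tilde\varphi$ is the zero extension of $\varphi$ to $\mathbb{R}$. With $m=[\alpha]$, ${}^{\pm}W^{\alpha,p}(U)=\{u\in W^{m,p}(U): {}^{\pm}\mathcal{D}^{\alpha}u\in L^p(U)\}$ with norm $(\|u\|_{W^{m,p}(U)}^p+\|{}^{\pm}\mathcal{D}^{\alpha}u\|_{L^p(U)}^p)^{1/p}$ (with $W^{0,p}=L^p$). *)

(* Defs.v *)
From HB Require Import structures.
From mathcomp Require Import all_boot all_order all_algebra.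
From mathcomp Require Import all_classical all_reals all_analysis.
Set Implicit Arguments.
Unset Strict Implicit.
Unset Printing Implicit Defensive.
Import Order.TTheory GRing.Theory Num.Theory.
Import numFieldNormedType.Exports.
Local Open Scope classical_set_scope.
Local Open Scope ring_scope.

Notation leb R := (@lebesgue_measure R).

Definition compactly_contained (R : realType) (A U : set R) : Prop :=
  compact (closure A) /\ closure A `<=` U.

(* An element of C_0^oo(U) is represented by its zero extension to R. *)
Definition test_function (R : realType) (U : set R) (phi : R -> R) : Prop :=
  (forall k x, derivable (derive1n k phi) x 1) /\
  compactly_contained [set x | phi x != 0] U.

Definition Gamma (R : realType) (t : R) : R :=
  \int[leb R]_(x in `]0, +oo[%classic) (x `^ (t - 1) * expR (- x)).

Inductive side := Left | Right.

Definition opposite (s : side) : side :=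
  match s with Left => Right | Right => Left end.

(* Left is the sign "-" and Right is the sign "+"; here n = [alpha] + 1. *)
Definition frac_derivative (R : realType) (s : side) (alpha : R)
    (phi : R -> R) (x : R) : R :=
  let n := (Num.truncn alpha).+1 in
  match s with
  | Left => (Gamma (n%:R - alpha))^-1 *
      derive1n n (fun z => \int[leb R]_(y in `]-oo, z[%classic)
         (phi y / (z - y) `^ (alpha - n%:R + 1))) x
  | Right => (-1) ^+ n / Gamma (n%:R - alpha) *
      derive1n n (fun z => \int[leb R]_(y in `]z, +oo[%classic)
         (phi y / (y - z) `^ (alpha - n%:R + 1))) x
  end.

(* Functions on U are represented by functions on R whose values outside U are
   irrelevant, and classes modulo a.e. equality on U by their representatives. *)
Definition Lp (R : realType) (p : R) (U : set R) (u : R -> R) : Prop :=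
  u \_ U \in Lfun (leb R) p%:E.

Definition Lp_norm (R : realType) (p : R) (U : set R) (u : R -> R) : \bar R :=
  'N[leb R]_p%:E[EFin \o u \_ U]%E.

(* The identities below are meant for u in some L^p(U), 1 <= p < +oo. *)
Definition is_weak_derivative (R : realType) (k : nat) (U : set R)
    (u v : R -> R) : Prop :=
  locally_integrable U v /\
  forall phi, test_function U phi ->
    \int[leb R]_(x in U) (v x * phi x) =
    (-1) ^+ k * \int[leb R]_(x in U) (u x * derive1n k phi x).

Definition is_weak_frac_derivative (R : realType) (s : side) (alpha : R)
    (U : set R) (u v : R -> R) : Prop :=
  locally_integrable U v /\
  forall phi, test_function U phi ->
    \int[leb R]_(x in U) (v x * phi x) =
    (-1) ^+ (Num.truncn alpha) *
    \int[leb R]_(x in U) (u x * frac_derivative (opposite s) alpha phi x).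

(* Weak derivatives are unique up to a.e. equality: any choice will do. *)
Definition weak_derivative (R : realType) (k : nat) (U : set R)
    (u : R -> R) : R -> R :=
  xget (cst 0) [set v | is_weak_derivative k U u v].

Definition weak_frac_derivative (R : realType) (s : side) (alpha : R)
    (U : set R) (u : R -> R) : R -> R :=
  xget (cst 0) [set v | is_weak_frac_derivative s alpha U u v].

Definition sobolev (R : realType) (m : nat) (p : R) (U : set R) : set (R -> R) :=
  [set u | Lp p U u /\ forall k, (1 <= k <= m)%N ->
     exists2 v, is_weak_derivative k U u v & Lp p U v].

Definition sobolev_norm (R : realType) (m : nat) (p : R) (U : set R)
    (u : R -> R) : \bar R :=
  ((Lp_norm p U u `^ p +
    \sum_(1 <= k < m.+1) Lp_norm p U (weak_derivative k U u) `^ p) `^ p^-1)%E.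

Definition frac_sobolev (R : realType) (s : side) (alpha p : R) (U : set R) :
    set (R -> R) :=
  [set u | sobolev (Num.truncn alpha) p U u /\
     exists2 v, is_weak_frac_derivative s alpha U u v & Lp p U v].

Definition frac_sobolev_norm (R : realType) (s : side) (alpha p : R)
    (U : set R) (u : R -> R) : \bar R :=
  ((sobolev_norm (Num.truncn alpha) p U u `^ p +
    Lp_norm p U (weak_frac_derivative s alpha U u) `^ p) `^ p^-1)%E.

(* E induces a mapping from A to B, viewed as sets of a.e.-classes of functions
   on U and on V respectively. *)
Definition class_mapping (R : realType) (U V : set R) (A B : set (R -> R))
    (E : (R -> R) -> (R -> R)) : Prop :=
  (forall u, A u -> B (E u)) /\
  (forall u v, A u -> A v -> u = v %[ae leb R in U] ->
     E u = E v %[ae leb R in V]).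

(* The support of an a.e.-class: the complement of the largest open set on
   which f vanishes a.e. *)
Definition ess_support (R : realType) (f : R -> R) : set R :=
  ~` \bigcup_(V in [set V | open V /\ f = cst 0 %[ae leb R in V]]) V.

(* Main.v *)
Require Import Defs.
From HB Require Import structures.
From mathcomp Require Import all_boot all_order all_algebra.
From mathcomp Require Import all_classical all_reals all_analysis.
From mathcomp Require Import measurable_realfun.
From mathcomp Require Import ring lra.
Set Implicit Arguments.
Unset Strict Implicit.
Unset Printing Implicit Defensive.
Import Order.TTheory GRing.Theory Num.Theory.
Import numFieldNormedType.Exports.
Local Open Scope ring_scope.
Local Open Scope classical_set_scope.

(** The extension is [E u = chi u], where [chi] is a cutoff equal to 1 on
    [Omega'] and supported in a compact subinterval of [Omega].

    The kernel [s^(n - alpha - 1)] of the fractional derivative is split into a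
    part supported in [[-d, d]], with [d] smaller than the distance of the
    support of [chi] to the boundary of [Omega], and a smooth part whose [n]-th
    derivative is integrable on the line.  The smooth part only contributes
    convolutions with integrable kernels, which are bounded on [L^p] by Young's
    inequality.  Let [J] be the convolution with the singular part.  Since
    [J (chi phi)] is still a test function on [Omega], the weak derivatives of
    [u] can be moved across [J]: modulo functionals represented by [L^p]
    functions, [int chi u (J phi)^(m+1)] reduces to
    [(-1)^m int chi u^(m) (J phi)'].  After an integration by parts, the
    commutator [chi (J phi)' - (J (chi phi))'] has the kernel
    [ker0' (y - x) (chi y - chi x)], which is [O(|y - x|^(n - alpha - 1))] and
    hence integrable.  Finally [int u^(m) (J (chi phi))'] is, up to the smooth
    part again, the weak fractional derivative of [u] tested against [chi phi]. *)

(** * Smooth functions *)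

(** The obstacle is nonlocality: a test function on the line need not vanish near the ends of
    [Omega], while the identities known for [u] hold only against test functions on [Omega], such as
    [chi phi]. The commutator is formed at order one, after [m] derivatives have been shifted to
    [u], because the Lipschitz bound on [chi] gains exactly one power of the distance. This repairs
    the non-integrable [ker0'], but would not repair a higher derivative of [ker0].

    The [L^p] function representing a remainder is produced directly, by exchanging integrals, and
    not by duality with [L^q]; so [p = 1] is covered too.

    Two further points come from the statement. The norms are built on chosen weak derivatives, so
    uniqueness on the line is needed to compare them with the functions constructed. And the
    constant may depend only on [alpha], [p] and [K], while the estimates depend on [a], [b] and
    [d]; hence [K] is a segment with an isolated point added, from which these three numbers can be
    recovered. *)

Definition Dn (R : realType) (k : nat) (O : set R) (f : R -> R) : Prop :=
  forall j x, (j <= k)%N -> O x -> derivable (derive1n j f) x 1.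

Definition smooth (R : realType) (f : R -> R) : Prop :=
  forall k x, derivable (derive1n k f) x 1.

Section Smooth.
Variable R : realType.
Implicit Types (O : set R) (f g : R -> R) (k j : nat) (x c : R).

Lemma smoothE f : smooth f <-> forall k, Dn k setT f.
Proof.
split=> [sf k j x _ _|h k x]; first exact: sf.
exact: (h k k x (leqnn k)).
Qed.

Lemma derive1nSr f k : derive1n k.+1 f = derive1n k (derive1 f).
Proof. by rewrite /derive1n iterSr. Qed.

(** The derivative is peeled off from the inside, so closure under sums, products and inverses
    follows by induction on [k] with [derive1 f] as the new function. Working on an open set [O]
    allows for powers, which are regular on the half-line only. *)
Lemma DnS k O f :
  Dn k.+1 O f <-> (forall x, O x -> derivable f x 1) /\ Dn k O (derive1 f).
Proof.
split=> [h|[h0 h1] [|j] x jk Ox]; last 2 first.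
- exact: h0.
- by rewrite derive1nSr; exact: h1.
split=> [x Ox|j x jk Ox]; first exact: (h 0%N).
by rewrite -derive1nSr; exact: h.
Qed.

Lemma Dn0 O f : (forall x, O x -> derivable f x 1) -> Dn 0 O f.
Proof. by move=> h j x; rewrite leqn0 => /eqP -> /h. Qed.

Lemma DnW k O f : Dn k.+1 O f -> Dn k O f.
Proof. by move=> h j x jk; apply: h; rewrite (leq_trans jk). Qed.

Lemma open_near O x (P : R -> Prop) : open O -> O x ->
  (forall y, O y -> P y) -> \near x, P x.
Proof. by move=> oO Ox OP; apply: filterS OP _; exact: open_nbhs_nbhs. Qed.

Lemma eq_on_derivable O f g x : open O -> O x ->
  (forall y, O y -> f y = g y) -> derivable f x 1 -> derivable g x 1.
Proof.
move=> oO Ox fg; apply: near_eq_derivable.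
by apply: (open_near oO Ox) => y /fg.
Qed.

Lemma eq_on_derive1 O f g x : open O -> O x ->
  (forall y, O y -> f y = g y) -> (derive1 f) x = (derive1 g) x.
Proof.
move=> oO Ox fg; rewrite !derive1E; apply: near_eq_derive.
by apply: (open_near oO Ox) => y /fg.
Qed.

Lemma eq_on_derive1n O f g k x : open O -> O x ->
  (forall y, O y -> f y = g y) -> derive1n k f x = derive1n k g x.
Proof.
move=> oO Ox fg; elim: k x Ox => [x /fg //|k ih] x Ox.
rewrite !derive1nS; exact: (eq_on_derive1 oO).
Qed.

Lemma eq_on_Dn k O f g : open O -> (forall y, O y -> f y = g y) ->
  Dn k O f -> Dn k O g.
Proof.
move=> oO fg h j x jk Ox; apply: (eq_on_derivable oO Ox _ (h j x jk Ox)).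
by move=> y Oy; exact: (eq_on_derive1n _ oO).
Qed.

Lemma subset_Dn k (A B : set R) f : A `<=` B -> Dn k B f -> Dn k A f.
Proof. by move=> AB h j x jk /AB; exact: h. Qed.

Lemma Dn_setU k (A B : set R) f : Dn k A f -> Dn k B f -> Dn k (A `|` B) f.
Proof. by move=> hA hB j x jk [|]; [exact: hA|exact: hB]. Qed.

Lemma derive1_cst_fun c : derive1 (fun _ : R => c) = cst 0.
Proof. by apply/funext => x; rewrite derive1_cst. Qed.

Lemma Dn_cst k O c : Dn k O (cst c).
Proof.
elim: k c => [|k ih] c; first by apply: Dn0 => x _; exact: derivable_cst.
apply/DnS; split; first by move=> x _; exact: derivable_cst.
by rewrite derive1_cst_fun; exact: ih.
Qed.

Lemma Dn_add k O f g : open O -> Dn k O f -> Dn k O g -> Dn k O (f \+ g).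
Proof.
move=> oO; elim: k f g => [|k ih] f g hf hg.
  by apply: Dn0 => x Ox; apply: derivableD; [exact: (hf 0%N)|exact: (hg 0%N)].
case/DnS: (hf) => hf0 hf1; case/DnS: (hg) => hg0 hg1; apply/DnS; split.
  by move=> x Ox; apply: derivableD; [exact: hf0|exact: hg0].
apply: (@eq_on_Dn _ _ ((derive1 f) \+ (derive1 g)) _ oO); last exact: ih.
by move=> y Oy /=; rewrite !derive1E deriveD; [|exact: hf0|exact: hg0].
Qed.

Lemma Dn_mul k O f g : open O -> Dn k O f -> Dn k O g -> Dn k O (f \* g).
Proof.
move=> oO; elim: k f g => [|k ih] f g hf hg.
  by apply: Dn0 => x Ox; apply: derivableM; [exact: (hf 0%N)|exact: (hg 0%N)].
case/DnS: (hf) => hf0 hf1; case/DnS: (hg) => hg0 hg1; apply/DnS; split.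
  by move=> x Ox; apply: derivableM; [exact: hf0|exact: hg0].
apply: (@eq_on_Dn _ _ ((f \* (derive1 g)) \+ (g \* (derive1 f))) _ oO).
  by move=> y Oy /=; rewrite !derive1E deriveM; [|exact: hf0|exact: hg0].
apply: (Dn_add oO).
  exact: (ih _ _ (DnW hf) hg1).
exact: (ih _ _ (DnW hg) hf1).
Qed.

Lemma Dn_inv k O f : open O -> (forall x, O x -> f x != 0) ->
  Dn k O f -> Dn k O (fun x => (f x)^-1).
Proof.
move=> oO f0; elim: k => [|k ih] hf.
  by apply: Dn0 => x Ox; apply: derivableV; [exact: f0|exact: (hf 0%N)].
case/DnS: (hf) => hf0 hf1; apply/DnS; split.
  by move=> x Ox; apply: derivableV; [exact: f0|exact: hf0].
(* The derivative [- f' / f^2] contains [1 / f] again, but only to order [k], where the induction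
   hypothesis applies. *)
have hi := ih (DnW hf).
apply: (@eq_on_Dn _ _ (cst (-1) \*
  (derive1 f \* ((fun x => (f x)^-1) \* (fun x => (f x)^-1)))) _ oO).
  move=> y Oy /=; rewrite !derive1E deriveV; [|exact: f0|exact: hf0].
  by rewrite /GRing.scale/= mulN1r mulNr -exprVn expr2 mulrC.
apply: (Dn_mul oO (@Dn_cst _ _ _)); apply: (Dn_mul oO hf1).
exact: (Dn_mul oO hi hi).
Qed.

Lemma smooth_cst c : smooth (cst c).
Proof. by apply/smoothE => k; exact: Dn_cst. Qed.

Lemma smooth_add f g : smooth f -> smooth g -> smooth (f \+ g).
Proof.
move=> /smoothE hf /smoothE hg; apply/smoothE => k.
exact: Dn_add openT (hf k) (hg k).
Qed.

Lemma smooth_mul f g : smooth f -> smooth g -> smooth (f \* g).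
Proof.
move=> /smoothE hf /smoothE hg; apply/smoothE => k.
exact: Dn_mul openT (hf k) (hg k).
Qed.

Lemma smooth_scale c f : smooth f -> smooth (fun x => c * f x).
Proof. by move=> sf; apply: smooth_mul (@smooth_cst c) sf. Qed.

Lemma smooth_opp f : smooth f -> smooth (fun x => - f x).
Proof.
move=> sf; rewrite (_ : (fun _ => _) = (fun x => -1 * f x)).
  exact: smooth_scale.
by apply/funext => x; rewrite mulN1r.
Qed.

Lemma smooth_inv f : (forall x, f x != 0) -> smooth f ->
  smooth (fun x => (f x)^-1).
Proof.
move=> f0 /smoothE hf; apply/smoothE => k.
by apply: Dn_inv => //; exact: openT.
Qed.

Lemma smooth_derivable f : smooth f -> forall x, derivable f x 1.
Proof. by move=> sf x; exact: (sf 0%N). Qed.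

Lemma smooth_continuous f : smooth f -> continuous f.
Proof.
move=> sf x; apply/differentiable_continuous/derivable1_diffP.
exact: smooth_derivable.
Qed.

Lemma smooth_derive1n f k : smooth f -> smooth (derive1n k f).
Proof. by move=> sf j x; rewrite /derive1n -iterD; exact: sf. Qed.

Lemma smooth_derive1 f : smooth f -> smooth (derive1 f).
Proof. exact: (@smooth_derive1n f 1). Qed.

Lemma derive1nD f g k : smooth f -> smooth g ->
  derive1n k (f \+ g) = derive1n k f \+ derive1n k g.
Proof.
move=> sf sg; elim: k => [//|k ih]; rewrite !derive1nS ih.
by apply/funext => x /=; rewrite !derive1E deriveD; [|exact: sf|exact: sg].
Qed.

Lemma derive1M f g x : derivable f x 1 -> derivable g x 1 ->
  derive1 (f \* g) x = derive1 f x * g x + f x * derive1 g x.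
Proof.
move=> df dg; rewrite !derive1E (deriveM df dg) addrC.
by rewrite /GRing.scale/= [g x * _]mulrC.
Qed.

Lemma is_derive_affine (s c x : R) : is_derive x 1 (fun y => c + s * y) s.
Proof.
have -> : (fun y => c + s * y) = cst c \+ (s \*: id) by [].
by apply: is_derive_eq; rewrite /GRing.scale/= mulr1 add0r.
Qed.

Lemma derivable_affine f (s c x : R) : derivable f (c + s * x) 1 ->
  derivable (fun y => f (c + s * y)) x 1.
Proof.
move=> df; have da := is_derive_affine s c x.
apply/derivable1_diffP.
apply: (@differentiable_comp _ _ _ _ (fun y => c + s * y) f).
  by apply/derivable1_diffP; case: da.
by apply/derivable1_diffP; exact: df.
Qed.

Lemma derive1_affine f (s c x : R) : derivable f (c + s * x) 1 ->
  derive1 (fun y => f (c + s * y)) x = s * (derive1 f) (c + s * x).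
Proof.
move=> df; have da := is_derive_affine s c x.
rewrite (@derive1_comp _ (fun y => c + s * y) f); [|by case: da|exact: df].
by rewrite [X in _ * X]derive1E derive_val mulrC.
Qed.

Lemma derive1n_affine f (s c : R) k : smooth f ->
  derive1n k (fun x => f (c + s * x)) = (fun x => s ^+ k * derive1n k f (c + s * x)).
Proof.
move=> sf; elim: k => [|k ih]; first by apply/funext => x; rewrite mul1r.
rewrite derive1nS ih; apply/funext => x.
rewrite derive1Ml; last by apply: derivable_affine; exact: sf.
by rewrite derive1_affine ?exprSr ?mulrA//; exact: sf.
Qed.

Lemma smooth_affine f (s c : R) : smooth f -> smooth (fun x => f (c + s * x)).
Proof.
move=> sf k x; rewrite derive1n_affine//.
by apply: derivableM; [exact: derivable_cst|apply: derivable_affine; exact: sf].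
Qed.

End Smooth.

(** * A smooth step *)

Section Bump.
Variable R : realType.
Implicit Types (x : R) (k : nat).

(** The functions [x^(-k) e^(-1/x)], extended by 0, form a family whose derivatives are linear
    combinations of its members. Smoothness of all of them thus reduces to differentiability. *)
Definition flat k x : R := if 0 < x then (x^-1) ^+ k * expR (- x^-1) else 0.

Lemma flat_ge0 k x : 0 <= flat k x.
Proof.
rewrite /flat; case: ifPn => // x0.
by rewrite mulr_ge0 ?expR_ge0// exprn_ge0// invr_ge0 ltW.
Qed.

Lemma flat_gt0 x : 0 < x -> 0 < flat 0 x.
Proof. by move=> x0; rewrite /flat x0 expr0 mul1r expR_gt0. Qed.

Lemma flat0 k x : x <= 0 -> flat k x = 0.
Proof. by move=> x0; rewrite /flat ltNge x0. Qed.

(** Comes from [e^y >= 1 + y^(k+1) / (k+1)!] at [y = 1/x]. The linear bound is what makes the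
    functions continuous at 0. *)
Lemma flat_le k x : 0 < x -> flat k x <= (k.+1)`!%:R * x.
Proof.
move=> x0; rewrite /flat x0 expRN; set y := x^-1.
have y0 : 0 < y by rewrite invr_gt0.
have h := expR_ge1Dxn k (ltW y0).
have f0 : 0 < (k.+1)`!%:R :> R by rewrite ltr0n fact_gt0.
rewrite ler_pdivrMr ?expR_gt0//.
apply: (@le_trans _ _ ((k.+1)`!%:R * x * (y ^+ k.+1 / (k.+1)`!%:R))); last first.
  by rewrite ler_wpM2l ?mulr_ge0 ?(ltW f0) ?(ltW x0)// (le_trans _ h)// lerDr.
rewrite exprS /y le_eqVlt; apply/orP; left; apply/eqP; field.
by rewrite (gt_eqF f0) (gt_eqF x0).
Qed.

Lemma near_gt0 x : 0 < x -> \forall y \near x, 0 < y.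
Proof.
move=> x0; apply: (@open_near _ `]0, +oo[%classic).
- exact: interval_open.
- by rewrite /= in_itv/= x0.
- by move=> y; rewrite /= in_itv/= andbT.
Qed.

Lemma near_lt0 x : x < 0 -> \forall y \near x, y < 0.
Proof.
move=> x0; apply: (@open_near _ `]-oo, 0[%classic).
- exact: interval_open.
- by rewrite /= in_itv/= x0.
- by move=> y; rewrite /= in_itv/=.
Qed.

Lemma flat_derivative k x :
  is_derive x (1 : R) (flat k) (flat k.+2 x - k%:R * flat k.+1 x).
Proof.
have [x0|x0|->] := ltgtP x 0.
- rewrite !flat0 ?ltW// mulr0 subr0.
  have E : \forall y \near x, (fun _ => 0) y = flat k y.
    by apply: filterS (near_lt0 x0) => y /= y0; rewrite flat0// ltW.
  exact: (near_eq_is_derive E (is_derive_cst (0 : R) x 1)).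
- have E : \forall y \near x, y^-1 ^+ k * expR (- y^-1) = flat k y.
    by apply: filterS (near_gt0 x0) => y /= y0; rewrite /flat y0.
  apply: (near_eq_is_derive E).
  have xn0 : x != 0 by rewrite gt_eqF.
  have dV : is_derive x (1 : R) (fun y : R => y^-1) (- x ^- 2).
    have := @is_deriveV R id x 1 1 xn0 (is_derive_id _ _).
    by rewrite /GRing.scale/= mulr1.
  have dX := @is_deriveX R R (fun y : R => y^-1) k x 1 _ dV.
  have dN := @is_deriveN R _ _ (fun y : R => y^-1) x 1 _ dV.
  have dE := @is_derive1_comp R expR (fun y : R => - y^-1) x _ _
     (is_derive_expR _) dN.
  have dM := @is_deriveM R _ _ _ x 1 _ _ dX dE.
  rewrite (_ : (fun y => _) = (GRing.inv ^+ k * (expR \o (fun y : R => - y^-1)))).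
    refine (@is_derive_eq R R R _ _ _ _ _ dM _).
    rewrite /flat x0 /GRing.scale/= !exprfctE/=.
    case: k {E dX dM} => [|k].
      rewrite -!exprVn; set y := x^-1; set E := expR (- y); ring.
    rewrite /= -!exprVn !exprS; set y := x^-1; set E := expR (- y); ring.
  by apply/funext => y; rewrite /= !fctE.
(* At 0 the difference quotient of [flat k] is [flat k.+1], which tends to 0. *)
- rewrite !flat0// mulr0 subr0; apply/is_derive1_caratheodory.
  exists (flat k.+1); split.
  + move=> z; rewrite (@flat0 _ 0)// !subr0 /flat; case: ifPn => [z0|_].
      by rewrite exprS; field; rewrite gt_eqF.
    by rewrite mul0r.
  + apply/(@cvgrPdist_lt _ R) => e e0; near=> z.
    rewrite (@flat0 _ 0)// sub0r normrN ger0_norm ?flat_ge0//.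
    have [z0|z0] := ltP 0 z; last by rewrite flat0.
    rewrite (le_lt_trans (flat_le _ z0))// mulrC -ltr_pdivlMr ?ltr0n ?fact_gt0//.
    rewrite -[ltLHS]gtr0_norm// -[z]subr0 distrC.
    near: z; exists (e / k.+2`!%:R) => //=.
    by rewrite divr_gt0// ltr0n fact_gt0.
  + by rewrite flat0.
Unshelve. all: by end_near. Qed.

Lemma Dn_flat j k : Dn j setT (flat k).
Proof.
elim: j k => [|j ih] k.
  by apply: Dn0 => x _; case: (flat_derivative k x).
apply/DnS; split=> [x _|]; first by case: (flat_derivative k x).
have -> : derive1 (flat k) =
    flat k.+2 \+ (cst (- k%:R) \* flat k.+1).
  apply/funext => x; rewrite derive1E; have [_ ->] := flat_derivative k x.
  by rewrite /= mulNr.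
by apply: (Dn_add openT (ih _)); exact: (Dn_mul openT (@Dn_cst _ _ _ _) (ih _)).
Qed.

Lemma smooth_flat k : smooth (flat k).
Proof. by apply/smoothE => j; exact: Dn_flat. Qed.

Let den x := flat 0 x + flat 0 (1 - x).

Let den_gt0 x : 0 < den x.
Proof.
rewrite /den; have [x0|x0] := ltP 0 x.
  by rewrite ltr_wpDr ?flat_ge0// flat_gt0.
by rewrite ltr_wpDl ?flat_ge0// flat_gt0// subr_gt0 (le_lt_trans x0).
Qed.

(** The classical transition [f(x) / (f(x) + f(1 - x))] for [f = flat 0]. The denominator is
    positive because [x] and [1 - x] cannot both be nonpositive. *)
Definition step x : R := flat 0 x * (flat 0 x + flat 0 (1 - x))^-1.

Lemma smooth_step : smooth step.
Proof.
apply: smooth_mul; first exact: smooth_flat.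
apply: (@smooth_inv _ den); first by move=> x; rewrite gt_eqF.
apply: smooth_add; first exact: smooth_flat.
rewrite (_ : (fun x => _) = (fun x => flat 0 (1 + -1 * x))).
  by apply: smooth_affine; exact: smooth_flat.
by apply/funext => x; rewrite mulN1r.
Qed.

Lemma step_ge0 x : 0 <= step x.
Proof. by rewrite mulr_ge0 ?flat_ge0// invr_ge0 ltW// den_gt0. Qed.

Lemma step_le1 x : step x <= 1.
Proof. by rewrite ler_pdivrMr ?den_gt0// mul1r lerDl flat_ge0. Qed.

Lemma step_eq0 x : x <= 0 -> step x = 0.
Proof. by move=> x0; rewrite /step flat0// mul0r. Qed.

Lemma step_eq1 x : 1 <= x -> step x = 1.
Proof.
move=> x1; rewrite /step (@flat0 0 (1 - x)) ?subr_le0// addr0 divff// gt_eqF//.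
by rewrite flat_gt0// (lt_le_trans _ x1).
Qed.

End Bump.

(** * Supports and affine changes of variable *)

Section Support.
Variable R : realType.
Implicit Types (c d x : R) (f g phi : R -> R) (k : nat).

(** Explicit bounds replace the topological support: they pass to derivatives and are easily
    enlarged. No order between [c] and [d] is imposed; for [c > d] the function is 0. *)
Definition vanishes_off c d f := forall x, ~~ (c <= x <= d) -> f x = 0.

Lemma vanishes_off_derive1n c d f k :
  vanishes_off c d f -> vanishes_off c d (derive1n k f).
Proof.
move=> vf x xcd.
have -> : derive1n k f x = derive1n k (cst 0) x.
  apply: (@eq_on_derive1n R (~` `[c, d]%classic)).
  - exact/closed_openC/itv_closed.
  - by rewrite /= in_itv/=; exact/negP.
  - by move=> y /=; rewrite in_itv/= => /negP /vf ->.
elim: k x {xcd} => [//|k ih] x.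
rewrite derive1nS (_ : derive1n k (cst 0) = cst 0) ?derive1_cst//.
by apply/funext => y; exact: ih.
Qed.

Lemma vanishes_off_continuous_bounded c d f : continuous f ->
  vanishes_off c d f -> exists2 B : R, 0 <= B & forall x, `|f x| <= B.
Proof.
move=> cf vf; have [cd|dc] := leP c d; last first.
  exists 0 => // x; rewrite vf ?normr0//.
  by apply/negP => /andP[cx xd]; have := le_trans cx xd; rewrite leNgt dc.
have cn : {within `[c, d], continuous (fun x => `|f x|)}.
  apply: continuous_subspaceT => x.
  by apply: continuous_comp (cf x) _; exact: (@norm_continuous R R).
have [z zcd mz] := EVT_max cd cn.
exists (`|f z|) => // x; have [xcd|xcd] := boolP (c <= x <= d); last by rewrite vf ?normr0.
by apply: mz; rewrite in_itv.
Qed.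

Lemma vanishes_off_ler c d c' d' f : c' <= c -> d <= d' ->
  vanishes_off c d f -> vanishes_off c' d' f.
Proof.
move=> cc dd vf x; apply: contraNeq => fx; have : c <= x <= d.
  by apply: contraNT fx => /vf ->.
by move=> /andP[cx xd]; rewrite (le_trans cc cx) (le_trans xd dd).
Qed.

Lemma smooth_measurable f : smooth f -> measurable_fun setT f.
Proof. by move=> /smooth_continuous; exact: continuous_measurable_fun. Qed.

Lemma vanishes_off_support c d (U : set R) phi : `[c, d]%classic `<=` U ->
  vanishes_off c d phi -> compactly_contained [set x | phi x != 0] U.
Proof.
move=> cdU vf.
have cl : closure [set x | phi x != 0] `<=` `[c, d]%classic.
  rewrite [X in _ `<=` X](closure_id _).1; last exact: itv_closed.
  apply: closureS => x /= fx; rewrite in_itv/=; apply: contraNT fx.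
  by move=> /vf ->.
split; last by move=> x /cl /cdU.
apply: subclosed_compact cl; first exact: closed_closure.
exact: segment_compact.
Qed.

(** The end points are the extreme values of the identity on [K]; an empty [K] gets the degenerate
    segment at the midpoint. *)
Lemma compact_sub_itv (K : set R) a b : a < b -> compact K -> K `<=` `]a, b[%classic ->
  exists c d, [/\ a < c, c <= d, d < b & K `<=` `[c, d]%classic].
Proof.
move=> ab cK Kab; have [->|/set0P K0] := eqVneq K set0.
  exists ((a + b) / 2), ((a + b) / 2); split; [lra|lra|lra|by []].
have cid : {within K, continuous (@id R)}.
  by apply: continuous_subspaceT => x; exact: cvg_id.
have [d /set_mem Kd hd] := compact_EVT_max K0 cK cid.
have [c /set_mem Kc hc] := compact_EVT_min K0 cK cid.
have := Kab _ Kd; have := Kab _ Kc; rewrite /= !in_itv/= => /andP[ac _] /andP[_ db].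
exists c, d; split => //; first by apply: hc; rewrite inE.
by move=> x Kx /=; rewrite in_itv/= hc ?hd// inE.
Qed.

Lemma test_function_itvP a b phi : a < b ->
  test_function `]a, b[%classic phi <->
  smooth phi /\ exists c d, [/\ a < c, c <= d, d < b & vanishes_off c d phi].
Proof.
move=> ab; split=> [[sp [cp /(compact_sub_itv ab cp)]]|[sp]].
  move=> [c [d [ac cd db h]]]; split=> //; exists c, d; split => // x.
  apply: contraNeq => fx; have := h x; rewrite /= in_itv/=; apply.
  exact: subset_closure.
move=> [c [d [ac cd db vf]]]; split=> //; apply: vanishes_off_support vf.
move=> x /=; rewrite !in_itv/= => /andP[cx xd].
by rewrite (lt_le_trans ac)// (le_lt_trans xd).
Qed.

Lemma test_functionTP phi : test_function setT phi <->
  smooth phi /\ exists M, vanishes_off (- M) M phi.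
Proof.
split=> [[sp [cp _]]|[sp [M vf]]].
  split=> //; have [M [_ hM]] := compact_bounded cp.
  exists (M + 1) => x; apply: contraNeq => fx; rewrite -ler_norml.
  by apply: hM; [rewrite ltrDl|exact: subset_closure].
by split=> //; exact: vanishes_off_support vf.
Qed.

End Support.

Section Affine_invariance.
Variable R : realType.
Local Notation mu := (@lebesgue_measure R).
Implicit Types (c s : R) (f : R -> \bar R).

Lemma measurable_affine c s : measurable_fun setT (fun x : R => c + s * x).
Proof. by apply: measurable_funD => //; exact: measurable_funM. Qed.

(** Lebesgue measure is determined by its values on half-open intervals. A reflection exchanges the
    open and the closed end, so the two signs are computed separately. *)
Lemma lebesgue_measure_affine c s A : s = 1 \/ s = -1 -> measurable A ->
  mu A = pushforward mu ((fun x : R => c + s * x) : _ -> measurableTypeR R) A.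
Proof.
move=> s1 mA; have ms := measurable_affine c s.
move: mA => mA; apply: lebesgue_measure_unique => //= _ [[x y] _ <-] /=.
rewrite /pushforward; case: s1 => -> /=.
  rewrite (_ : _ @^-1` _ = `]x - c, y - c]%classic); last first.
    apply/seteqP; split=> z /=; rewrite !in_itv/= mul1r => /andP[? ?];
      by apply/andP; split; lra.
  rewrite !lebesgue_measure_itv/= !lte_fin ltrD2r.
  by case: ifPn => // _; rewrite -!EFinB; congr EFin; ring.
rewrite (_ : _ @^-1` _ = `[c - y, c - x[%classic); last first.
  apply/seteqP; split=> z /=; rewrite !in_itv/= mulN1r => /andP[? ?];
      by apply/andP; split; lra.
rewrite !lebesgue_measure_itv/= !lte_fin ltrD2l ltrN2.
by case: ifPn => // _; rewrite -!EFinB; congr EFin; ring.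
Qed.

Lemma ge0_integral_affine c s f : s = 1 \/ s = -1 ->
  measurable_fun setT f -> (forall x, 0 <= f x)%E ->
  (\int[mu]_x f (c + s * x)%R = \int[mu]_x f x)%E.
Proof.
move=> s1 mf f0.
pose phi : R -> measurableTypeR R := fun x => c + s * x.
have mphi : measurable_fun setT phi by exact: measurable_affine.
transitivity (\int[pushforward mu phi]_(x in setT) f x)%E; last first.
  by apply: eq_measure_integral => A mA _; exact/esym/(lebesgue_measure_affine c s1 mA).
by rewrite ge0_integral_pushforward// => x _; exact: f0.
Qed.

Lemma integral_affine c s f : s = 1 \/ s = -1 -> measurable_fun setT f ->
  (\int[mu]_x f (c + s * x)%R = \int[mu]_x f x)%E.
Proof.
move=> s1 mf; rewrite integralE [RHS]integralE; congr (_ - _)%E.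
  rewrite -(ge0_integral_affine c s1 (measurable_funepos mf)).
    by apply: eq_integral => x _; rewrite !funeposE.
  by move=> x; exact: funepos_ge0.
rewrite -(ge0_integral_affine c s1 (measurable_funeneg mf)).
  by apply: eq_integral => x _; rewrite !funenegE.
by move=> x; exact: funeneg_ge0.
Qed.

Lemma Rintegral_affine c s (g : R -> R) : s = 1 \/ s = -1 ->
  measurable_fun setT g ->
  \int[mu]_x g (c + s * x) = \int[mu]_x g x.
Proof.
move=> s1 mg; congr fine; apply: (integral_affine c s1 (f := EFin \o g)).
exact/measurable_EFinP.
Qed.

Lemma integrable_affine c s f : s = 1 \/ s = -1 ->
  mu.-integrable setT f -> mu.-integrable setT (fun x => f (c + s * x)%R).
Proof.
move=> s1 /integrableP[mf fi]; apply/integrableP; split.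
  exact: (measurableT_comp mf (measurable_affine c s)).
rewrite (ge0_integral_affine c s1 (f := fun x => `|f x|%E))//.
exact: measurableT_comp.
Qed.

End Affine_invariance.

(** * Integration on the line *)

Section Integration.
Variable R : realType.
Local Notation mu := (@lebesgue_measure R).
Local Notation integ f := (mu.-integrable setT (EFin \o f)).
Implicit Types (a b c d x y z : R) (f g h A B phi : R -> R) (k : nat).

Lemma integ_le f g : measurable_fun setT f -> (forall x, `|f x| <= g x) ->
  integ g -> integ f.
Proof.
move=> mf fg; apply: le_integrable => //; first exact/measurable_EFinP.
by move=> x _ /=; rewrite lee_fin (le_trans (fg x))// ler_norm.
Qed.

Lemma integ_measurable f : integ f -> measurable_fun setT f.
Proof. by move=> /integrableP[/measurable_EFinP]. Qed.

Lemma integZ f c : integ f -> integ (fun x => c * f x).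
Proof. by move=> If; have := integrableZl measurableT c If. Qed.

Lemma integD f g : integ f -> integ g -> integ (fun x => f x + g x).
Proof. by move=> If Ig; have := integrableD measurableT If Ig. Qed.

Lemma integB f g : integ f -> integ g -> integ (fun x => f x - g x).
Proof. by move=> If Ig; have := integrableB measurableT If Ig. Qed.

Lemma integ_norm f : integ f -> integ (fun x => `|f x|).
Proof. by move=> If; have := integrable_abse If. Qed.

Lemma integ_mulr_bounded f g C : integ f -> measurable_fun setT g ->
  (forall x, `|g x| <= C) -> integ (fun x => f x * g x).
Proof.
move=> If mg gC; apply: (@integ_le _ (fun x => C * `|f x|)).
- by apply: measurable_funM => //; exact: integ_measurable.
- by move=> x; rewrite normrM mulrC ler_wpM2r.
- by apply: integZ; exact: integ_norm.
Qed.

Lemma bounded_vanishes_off_integ f M C : measurable_fun setT f ->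
  vanishes_off (- M) M f -> (forall x, `|f x| <= C) -> integ f.
Proof.
move=> mf vf fC.
apply: (@integ_le _ (fun x => C * \1_(`[- M, M]%classic) x)) => //.
  move=> x; have [xM|xM] := boolP (- M <= x <= M).
    by rewrite indicE mem_set/= ?in_itv//= mulr1.
  rewrite vf// normr0 mulr_ge0// ?(le_trans _ (fC 0))//.
by apply: integZ; exact: integrable_indic_itv.
Qed.

Lemma continuous_bounded_on f : continuous f -> forall M, 
  exists2 C : R, 0 <= C & forall x, `|x| <= M -> `|f x| <= C.
Proof.
move=> cf M; have [M0|M0] := leP 0 M; last first.
  by exists 0 => // x xM; have := le_lt_trans xM M0; rewrite ltNge normr_ge0.
have cn : {within `[- M, M], continuous (fun x => `|f x|)}.
  apply: continuous_subspaceT => x.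
  by apply: continuous_comp (cf x) _; exact: (@norm_continuous R R).
have MM : - M <= M by rewrite (le_trans _ M0)// oppr_le0.
have [z _ mz] := EVT_max MM cn.
by exists `|f z| => // x xM; apply: mz; rewrite in_itv/= -ler_norml.
Qed.

Section Convolution.
Variables (s M : R) (A : R -> R).
Hypotheses (IA : integ A) (vA : vanishes_off (- M) M A).

(** For [s = -1] this is the usual convolution. For [s = 1] it is a correlation, the form that
    [int A(y - z) B(y) dy] takes after a translation. *)
Definition conv A B z := \int[mu]_y (A y * B (z + s * y)).

Lemma conv_integ B z : continuous B -> integ (fun y => A y * B (z + s * y)).
Proof.
move=> cB; have [C C0 hC] := continuous_bounded_on cB (`|z| + `|s| * M).
have mB := continuous_measurable_fun cB.
have mA := integ_measurable IA.
have mBs : measurable_fun setT (fun y => B (z + s * y)).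
  exact: (measurableT_comp mB (measurable_affine z s)).
apply: (@integ_le _ (fun x => C * `|A x|)).
- exact: measurable_funM.
- move=> y; have [yM|yM] := boolP (- M <= y <= M); last by rewrite vA// mul0r normr0 mulr0.
  rewrite normrM mulrC ler_wpM2r// hC// (le_trans (ler_normD _ _))// lerD2l.
  by rewrite normrM ler_wpM2l// ler_norml.
- by apply: integZ; exact: integ_norm.
Qed.

Lemma conv_derive1 B : smooth B -> forall z,
  derivable (conv A B) z 1 /\ derive1 (conv A B) z = conv A (derive1 B) z.
Proof.
move=> sB z.
have sB' := smooth_derive1 sB.
(* This bounds [B'] at every point [u + s y] with [|u - z| < 1] and [|y| <= M], so [C |A|] dominates
   the differentiated integrand. *)
have [C C0 hC] := continuous_bounded_on (smooth_continuous sB') (`|z| + 1 + `|s| * M).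
pose f z y := A y * B (z + s * y).
have E (y : R) : (fun t : R => f t y) = (fun t => A y * B (s * y + 1 * t)).
  by apply/funext => t; rewrite /f mul1r addrC.
have Iz : `]z - 1, z + 1[%classic z by rewrite /= in_itv/=; apply/andP; split; lra.
have intf (u : R) : `]z - 1, z + 1[%classic u -> integ (f u).
  by move=> _; apply: conv_integ; exact: smooth_continuous.
have derf (u y : R) : `]z - 1, z + 1[%classic u -> setT y -> derivable (f ^~ y) u 1.
  move=> _ _; rewrite (E y); apply: derivableM; first exact: derivable_cst.
  by apply: derivable_affine; exact: smooth_derivable.
have derfE (u y : R) : derive1 (f ^~ y) u = A y * derive1 B (u + s * y).
  rewrite (E y) derive1Ml; last by apply: derivable_affine; exact: smooth_derivable.
  rewrite derive1_affine; last exact: smooth_derivable.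
  by rewrite !mul1r addrC.
have G0 (y : R) : 0 <= `|A y| * C by rewrite mulr_ge0.
have IG : integ (fun y => `|A y| * C).
  rewrite (_ : (fun y => _) = (fun y => C * `|A y|)).
    by apply: integZ; exact: integ_norm.
  by apply/funext => y; rewrite mulrC.
have Gub (u y : R) : `]z - 1, z + 1[%classic u -> setT y -> `|partial1of2 f u y| <= `|A y| * C.
  move=> /=; rewrite in_itv/= => /andP[u1 u2] _.
  rewrite /partial1of2 derfE normrM.
  have [yM|yM] := boolP (- M <= y <= M); last by rewrite vA// normr0 !mul0r.
  rewrite ler_wpM2l// hC// (le_trans (ler_normD _ _))// lerD//.
    have -> : u = z + (u - z) by ring.
    rewrite (le_trans (ler_normD _ _))// lerD2l ler_norml; apply/andP; split; lra.
  by rewrite normrM ler_wpM2l// ler_norml.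
split; first exact: (derivable_under_integral measurableT Iz intf derf G0 IG Gub).
rewrite (differentiation_under_integral measurableT Iz intf derf G0 IG Gub).
by apply: eq_Rintegral => y _; rewrite /partial1of2 derfE.
Qed.

Lemma derive1n_conv B k : smooth B ->
  derive1n k (conv A B) = conv A (derive1n k B).
Proof.
move=> sB; elim: k => [//|k ih]; rewrite !derive1nS ih; apply/funext => z.
by have [_ ->] := conv_derive1 (smooth_derive1n (k := k) sB) z.
Qed.

Lemma smooth_conv B : smooth B -> smooth (conv A B).
Proof.
move=> sB k z; rewrite derive1n_conv//.
by have [] := conv_derive1 (smooth_derive1n (k := k) sB) z.
Qed.

End Convolution.

(** Meant for [f] unbounded at an end point. The indefinite integral of [f] and [h] are both
    continuous up to the ends and have the same derivative inside, so by the mean value theorem they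
    differ by a constant. *)
Lemma FTC_oo a b h f : a < b -> {within `[a, b], continuous h} ->
  (forall x, a < x < b -> derivable h x 1 /\ derive1 h x = f x) ->
  (forall x, a < x < b -> {for x, continuous f}) ->
  mu.-integrable `[a, b] (EFin \o f) ->
  \int[mu]_(x in `[a, b]) f x = h b - h a.
Proof.
move=> ab ch dh cf If.
pose F x := \int[mu]_(t in `[a, x]) f t.
have cF : {within `[a, b], continuous F}.
  exact: (parameterized_integral_continuous (ltW ab) If).
have dF x : a < x < b -> derivable F x 1 /\ derive1 F x = f x.
  move=> /[dup] axb /andP[ax xb].
  exact: (continuous_FTC1_closed xb If ax (cf _ axb)).
have cFh : {within `[a, b], continuous (F \- h)}.
  by move=> x; apply: cvgB; [exact: cF|exact: ch].
have dFh x : x \in `]a, b[%R -> is_derive x 1 (F \- h) (cst 0 x).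
  rewrite in_itv/= => axb; have [dF1 dF2] := dF _ axb; have [dh1 dh2] := dh _ axb.
  split; first exact: (derivableB dF1 dh1).
  by rewrite (deriveB dF1 dh1) -!derive1E dF2 dh2 subrr.
have [c _ /= E] := MVT ab dFh cFh.
have Fa : F a = 0 by rewrite /F set_itv1 Rintegral_set1.
by move: E; rewrite Fa mul0r -/(F b); lra.
Qed.
End Integration.

(** * Integrals with one singular point, and integrability of powers *)

Section Singular.
Variable R : realType.
Local Notation mu := (@lebesgue_measure R).
Local Notation integ f := (mu.-integrable setT (EFin \o f)).
Implicit Types (a b c d x y z : R) (f g h : R -> R) (k : nat).

Lemma integ_itv f a b : integ f -> mu.-integrable `[a, b] (EFin \o f).
Proof. by apply: integrableS => //; exact: measurable_itv. Qed.

(** Integration by parts across a singularity: [h] is continuous at [x0] but need not be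
    differentiable there. The fundamental theorem is applied on each side of [x0]; the values at
    [x0] cancel, and those at [- N] and [N] vanish. *)
Lemma Rintegral_derive_eq0 h f x0 M : continuous h -> vanishes_off (- M) M h ->
  (forall x, x != x0 -> derivable h x 1 /\ derive1 h x = f x) ->
  (forall x, x != x0 -> {for x, continuous f}) ->
  integ f -> \int[mu]_x f x = 0.
Proof.
move=> ch vh dh cf If.
pose N := `|M| + `|x0| + 1.
have N0 : 0 < N by rewrite /N ltr_wpDl.
have x0N : - N < x0 < N.
  by rewrite -ltr_norml /N -addrA; have := normr_ge0 M; lra.
have MN : M < N.
  by rewrite /N; have := ler_norm M; have := normr_ge0 x0; lra.
have fN x : ~~ (- N <= x <= N) -> f x = 0.
  move=> xN; have xx0 : x != x0.
    by apply: contraNneq xN => ->; case/andP: x0N => ? ?; apply/andP; split; lra.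
  have [_ <-] := dh _ xx0.
  apply: (@vanishes_off_derive1n R (- N) N h 1) xN.
  apply: vanishes_off_ler vh; lra.
case/andP: (x0N) => Nx0 x0N'.
have h1 : \int[mu]_(x in `[- N, x0]) f x = h x0 - h (- N).
  apply: FTC_oo => //; first exact: continuous_subspaceT.
  - by move=> x /andP[_ xx0]; apply: dh; rewrite lt_eqF.
  - by move=> x /andP[_ xx0]; apply: cf; rewrite lt_eqF.
  - exact: integ_itv.
have h2 : \int[mu]_(x in `[x0, N]) f x = h N - h x0.
  apply: FTC_oo => //; first exact: continuous_subspaceT.
  - by move=> x /andP[xx0 _]; apply: dh; rewrite gt_eqF.
  - by move=> x /andP[xx0 _]; apply: cf; rewrite gt_eqF.
  - exact: integ_itv.
have hN : h N = 0.
  by apply: vh; apply/negP => /andP[_]; rewrite leNgt MN.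
have hNN : h (- N) = 0.
  by apply: vh; apply/negP => /andP[]; rewrite lerN2 leNgt MN.
have -> : \int[mu]_x f x = \int[mu]_(x in `[- N, N]) f x.
  rewrite [RHS]Rintegral_mkcond; apply: eq_Rintegral => x _.
  rewrite patchE; case: ifPn => // /negP; rewrite inE /= in_itv/= => /negP.
  exact: fN.
have := @Rintegral_itvB R f (BLeft (- N)) (BRight N) x0 (integ_itv _ _ If).
rewrite !bnd_simp => /(_ (ltW Nx0) (ltW x0N')).
rewrite Rintegral_itv_obnd_cbnd; last first.
  by apply: integrableS If => //; exact: measurable_itv.
rewrite h1 h2 hN hNN; lra.
Qed.

(** Monotone convergence along an exhaustion on which the integrals are uniformly bounded. *)
Lemma ge0_integ_bounded f (F : nat -> set R) (C : R) :
  measurable_fun setT f -> (forall x, 0 <= f x) ->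
  nondecreasing_seq F -> (forall n, measurable (F n)) ->
  (forall x, ~ (\bigcup_n F n) x -> f x = 0) ->
  (forall n, (\int[mu]_(x in F n) (f x)%:E <= C%:E)%E) -> integ f.
Proof.
move=> mf f0 ndF mF vF FC; apply/integrableP; split; first exact/measurable_EFinP.
have -> : (\int[mu]_x `|(EFin \o f) x| = \int[mu]_(x in \bigcup_n F n) (f x)%:E)%E.
  rewrite [RHS]integral_mkcond; apply: eq_integral => x _ /=.
  rewrite patchE ger0_norm//; case: ifPn => // /negP; rewrite inE => /vF ->.
  by [].
apply: (@le_lt_trans _ _ C%:E); last by rewrite ltry.
have cv : (\int[mu]_(x in F i) (f x)%:E)%E @[i --> \oo] -->
    (\int[mu]_(x in \bigcup_i F i) (f x)%:E)%E.
  apply: ge0_nondecreasing_set_cvg_integral => //.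
  - move=> i; apply/measurable_EFinP; exact: measurable_funTS.
  - by move=> i x _; rewrite lee_fin.
rewrite -(cvg_lim _ cv)//; apply: lime_le; first by apply/cvg_ex; eexists; exact: cv.
by apply: nearW => n; exact: FC.
Qed.

(** As [c] may have either sign, the formula serves both the singularity at 0 and the decay at
    infinity. *)
Lemma powR_integral c a b : 0 < a -> a < b -> c != 0 ->
  (\int[mu]_(x in `[a, b]) (x `^ (c - 1))%:E)%E = ((b `^ c - a `^ c) / c)%:E.
Proof.
move=> a0 ab c0.
have dpow e x : 0 < x -> is_derive x (1 : R) (fun y : R => y `^ e) (e * x `^ (e - 1)).
  exact: is_derive1_powR.
have cpow e x : 0 < x -> {for x, continuous (fun y : R => y `^ e)}.
  move=> x0; apply/differentiable_continuous/derivable1_diffP.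
  by case: (dpow e x x0).
have cw e : {within `[a, b], continuous (fun y : R => y `^ e)}.
  apply: continuous_in_subspaceT => x; rewrite inE/= in_itv/= => /andP[ax _].
  by apply: cpow; rewrite (lt_le_trans a0).
have Ip : mu.-integrable `[a, b] (EFin \o (fun x => x `^ (c - 1))).
  by apply: continuous_compact_integrable; [exact: segment_compact|exact: cw].
have h : \int[mu]_(x in `[a, b]) (x `^ (c - 1)) = b `^ c / c - a `^ c / c.
  apply: (FTC_oo (h := fun x => x `^ c / c)) => //.
  - move=> x; apply: cvgM; [exact: cw|exact: cvg_cst].
  - move=> x /andP[ax _]; have x0 := lt_trans a0 ax.
    have [dx dE] := dpow c x x0.
    split; first by apply: derivableM; [exact: dx|exact: derivable_cst].
    rewrite derive1Mr//; rewrite derive1E dE; by field.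
  - by move=> x /andP[ax _]; apply: cpow; exact: (lt_trans a0 ax).
rewrite mulrBl -h /Rintegral fineK//.
exact: (integrable_fin_num _ Ip).
Qed.

Lemma measurable_powR_if e (P : R -> bool) : measurable_fun setT P ->
  measurable_fun setT (fun x => if P x then x `^ e else 0).
Proof.
by move=> mP; apply: measurable_fun_ifT => //; exact: measurable_powR.
Qed.

Lemma integ_powR_near0 c d : 0 < c ->
  integ (fun x => if 0 < x <= d then x `^ (c - 1) else 0).
Proof.
move=> c0; set f := (fun x => _).
have mf : measurable_fun setT f.
  apply: measurable_powR_if; apply: measurable_and.
    by apply: measurable_fun_ltr.
  by apply: measurable_fun_ler.
have f0 x : 0 <= f x by rewrite /f; case: ifP => // _; exact: powR_ge0.
pose F (n : nat) : set R := `[n.+1%:R^-1, d]%classic.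
apply: (@ge0_integ_bounded f F (d `^ c / c)) => //.
- move=> m n mn; apply/subsetPset => x; rewrite /F /= !in_itv/= => /andP[mx ->].
  rewrite andbT (le_trans _ mx)// lef_pV2 ?posrE// ler_nat ltnS//.
- move=> n; exact: measurable_itv.
- move=> x xF; rewrite /f; case: ifPn => // /andP[x0 xd]; exfalso; apply: xF.
  exists (Num.truncn x^-1) => //; rewrite /F /= in_itv/= xd andbT.
  rewrite invf_ple ?posrE//; exact/ltW/truncnS_gt.
- move=> n; have n0 : 0 < n.+1%:R^-1 :> R by rewrite invr_gt0.
  (* For small [n] the interval [F n] is empty or a single point. *)
  have [dn|nd] := leP d n.+1%:R^-1.
    rewrite (@integral_Sset1 _ _ _ n.+1%:R^-1) ?lee_fin ?divr_ge0 ?powR_ge0 ?(ltW c0)//.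
    move=> x; rewrite /F /= in_itv/= => /andP[h1 h2]; apply: le_anti.
    by rewrite h1 (le_trans h2 dn).
  have -> : (\int[mu]_(x in F n) (f x)%:E =
      \int[mu]_(x in `[(n.+1%:R^-1)%R, d]) (x `^ (c - 1))%:E)%E.
    apply: eq_integral => x; rewrite inE /F/= in_itv/= => /andP[xn xd].
    by rewrite /f xd (lt_le_trans n0 xn).
  rewrite powR_integral// ?gt_eqF// lee_fin ler_pM2r ?invr_gt0//.
  by rewrite gerBl powR_ge0.
Qed.

Lemma integ_powR_tail c d : 0 < c -> 0 < d ->
  integ (fun x => if d <= x then x `^ (- c - 1) else 0).
Proof.
move=> c0 d0; set f := (fun x => _).
have mf : measurable_fun setT f.
  apply: measurable_powR_if; by apply: measurable_fun_ler.
have f0 x : 0 <= f x by rewrite /f; case: ifP => // _; exact: powR_ge0.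
pose F (n : nat) : set R := `[d, n%:R]%classic.
apply: (@ge0_integ_bounded f F (d `^ (- c) / c)) => //.
- move=> m n mn; apply/subsetPset => x; rewrite /F /= !in_itv/= => /andP[-> xm].
  by rewrite (le_trans xm)// ler_nat.
- move=> n; exact: measurable_itv.
- move=> x xF; rewrite /f; case: ifPn => // dx; exfalso; apply: xF.
  exists (Num.truncn x).+1 => //; rewrite /F /= in_itv/= dx.
  exact/ltW/truncnS_gt.
- move=> n.
  have [nd|dn] := leP (n%:R : R) d.
    rewrite (@integral_Sset1 _ _ _ d) ?lee_fin ?divr_ge0 ?powR_ge0 ?(ltW c0)//.
    move=> x; rewrite /F /= in_itv/= => /andP[h1 h2]; apply: le_anti.
    by rewrite h1 (le_trans h2 nd).
  have -> : (\int[mu]_(x in F n) (f x)%:E =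
      \int[mu]_(x in `[d, n%:R%R]) (x `^ (- c - 1))%:E)%E.
    by apply: eq_integral => x; rewrite inE /F/= in_itv/= => /andP[xn xd]; rewrite /f xn.
  rewrite powR_integral// ?oppr_eq0 ?gt_eqF// lee_fin.
  rewrite invrN mulrN -mulNr opprB ler_pM2r ?invr_gt0//.
  by rewrite gerBl powR_ge0.
Qed.

End Singular.

(** * Convolution operators on Lp *)

Section Lp_kernel.
Variable R : realType.
Local Notation mu := (@lebesgue_measure R).
Local Notation integ f := (mu.-integrable setT (EFin \o f)).
Local Notation rT := (measurableTypeR R).
Implicit Types (p : R) (f g h k phi : R -> R).

Lemma Lp_setT p f : Lp p setT f <-> f \in Lfun mu p%:E.
Proof. by rewrite /Lp patch_setT. Qed.

Definition in_Lp p f := measurable_fun setT f /\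
  (\int[mu]_x (`|f x| `^ p)%:E < +oo)%E.

Lemma Lp_norm_setT p f :
  Lp_norm p setT f = ((\int[mu]_x (`|f x| `^ p)%:E) `^ p^-1)%E.
Proof.
rewrite /Lp_norm patch_setT unlock /=; congr poweR.
Qed.

Lemma in_LpP p f : 1 <= p -> Lp p setT f <-> in_Lp p f.
Proof.
move=> p1; have p0 : 0 < p by rewrite (lt_le_trans _ p1).
have pi0 : p^-1 != 0 by rewrite invr_eq0 gt_eqF.
have nE : Lp_norm p setT f = ('N[mu]_p%:E[EFin \o f])%E by rewrite /Lp_norm patch_setT.
rewrite Lp_setT; split.
  rewrite inE => /andP[/[!inE]/= mf]; rewrite /finite_norm -nE Lp_norm_setT.
  by move=> /(lty_poweRy pi0).
move=> [mf h]; rewrite inE; apply/andP; split; rewrite inE//=.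
by rewrite /finite_norm -nE Lp_norm_setT; exact: poweR_lty.
Qed.

Lemma poweR_Lp_norm p f : 1 <= p ->
  (Lp_norm p setT f `^ p = \int[mu]_x (`|f x| `^ p)%:E)%E.
Proof.
move=> p1; have p0 : 0 < p by rewrite (lt_le_trans _ p1).
rewrite Lp_norm_setT -poweRrM mulVf ?gt_eqF// poweRe1//.
by apply: integral_ge0 => x _; rewrite lee_fin powR_ge0.
Qed.

Lemma Lp_norm_le p f (C : R) : 1 <= p -> 0 <= C ->
  (\int[mu]_x (`|f x| `^ p)%:E <= (C `^ p)%:E)%E ->
  (Lp_norm p setT f <= C%:E)%E.
Proof.
move=> p1 C0 h; have p0 : 0 < p by rewrite (lt_le_trans _ p1).
have -> : C%:E = ((C `^ p)%:E `^ p^-1)%E.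
  by rewrite poweR_EFin -powRrM mulfV ?gt_eqF// powRr1.
rewrite Lp_norm_setT; apply: gt0_ler_poweR => //.
- by rewrite invr_ge0 ltW.
- rewrite in_itv/= leey andbT; apply: integral_ge0 => x _.
  by rewrite lee_fin powR_ge0.
- by rewrite in_itv/= leey andbT lee_fin powR_ge0.
Qed.

Lemma measurable_sub12 : measurable_fun [set: rT * rT] (fun z : rT * rT => z.2 - z.1).
Proof. by apply: measurable_funB. Qed.

Section Young.
Variables (p : R) (f k : R -> R).
Hypotheses (p1 : 1 <= p) (mf : measurable_fun setT f).
Hypotheses (Ik : integ k) (k0 : forall s, 0 <= k s).

Let mk := integ_measurable Ik.
Let p0 : 0 < p. Proof. by rewrite (lt_le_trans _ p1). Qed.
Let K := \int[mu]_s k s.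
Let K0 : 0 <= K. Proof. exact: Rintegral_ge0. Qed.

(** The convolution of [|f|] with [k], kept in the extended reals because it may be infinite at some
    points. *)
Definition majorant y : \bar R := (\int[mu]_x (`|f x| * k (y - x))%:E)%E.
Local Notation H := majorant.

Let KE (y : R) : (\int[mu]_x (k (y - x))%:E = K%:E)%E.
Proof.
rewrite /K /Rintegral fineK; last exact: (integrable_fin_num _ Ik).
rewrite -(@integral_affine R y (-1) (EFin \o k)); last 2 first.
- by right.
- exact/measurable_EFinP.
by apply: eq_integral => x _; rewrite /= mulN1r.
Qed.

Lemma majorant_ge0 y : (0 <= H y)%E.
Proof. by apply: integral_ge0 => x _; rewrite lee_fin mulr_ge0. Qed.

Let mk2 : measurable_fun [set: rT * rT] (fun z : rT * rT => k (z.2 - z.1)).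
Proof. exact: (measurableT_comp mk measurable_sub12). Qed.

Let mf1 : measurable_fun [set: rT * rT] (fun z : rT * rT => f z.1).
Proof. exact: (measurableT_comp mf measurable_fst). Qed.

Lemma measurable_majorant : measurable_fun setT H.
Proof.
have := @measurable_fun_fubini_tonelli_G _ _ rT rT R mu
  (fun z => (`|f z.1| * k (z.2 - z.1))%:E).
apply.
  apply/measurable_EFinP; apply: measurable_funM => //.
  exact: measurableT_comp.
by move=> z; rewrite lee_fin mulr_ge0.
Qed.

Let mkx (x : R) : measurable_fun setT (fun y : R => k (y - x)).
Proof.
have -> : (fun y : R => k (y - x)) = (fun y : R => k (- x + 1 * y)).
  by apply/funext => y; rewrite mul1r addrC.
exact: (measurableT_comp mk (measurable_affine (- x) 1)).
Qed.

Let KE2 (x : R) : (\int[mu]_y (k (y - x))%:E = K%:E)%E.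
Proof.
rewrite /K /Rintegral fineK; last exact: (integrable_fin_num _ Ik).
rewrite -(@integral_affine R (- x) 1 (EFin \o k)); last 2 first.
- by left.
- exact/measurable_EFinP.
by apply: eq_integral => y _; rewrite /= mul1r addrC.
Qed.

Let mky (y : R) : measurable_fun setT (fun x : R => k (y - x)).
Proof.
have -> : (fun x : R => k (y - x)) = (fun x : R => k (y + -1 * x)).
  by apply/funext => x; rewrite mulN1r.
exact: (measurableT_comp mk (measurable_affine y (-1))).
Qed.

(** Hoelder's inequality after the splitting [k = k^(1/p) k^(1/q)], where the first factor goes with
    [|f|]; the second contributes the power [K^(p/q) = K^(p-1)]. *)
Lemma majorant_powR y :
  (H y `^ p <= (K `^ (p - 1))%:E * \int[mu]_x (`|f x| `^ p * k (y - x))%:E)%E.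
Proof.
(* The case [p = 1] is apart, since its conjugate exponent is infinite; there both sides agree. *)
move: p1; rewrite le_eqVlt => /predU1P[<-|p1'].
  rewrite subrr powRr0 mul1e poweRe1 ?majorant_ge0//.
  rewrite le_eqVlt; apply/orP; left; apply/eqP; apply: eq_integral => x _.
  by rewrite powRr1.
pose q := p / (p - 1).
have q0 : 0 < q by rewrite divr_gt0// subr_gt0.
have pm0 : p - 1 != 0 by rewrite gt_eqF// subr_gt0.
have pn0 : p != 0 by rewrite gt_eqF.
have pq : p^-1 + q^-1 = 1 by rewrite /q; field; rewrite pm0.
pose f1 x := `|f x| * k (y - x) `^ p^-1.
pose f2 x := k (y - x) `^ q^-1.
have mf2 : measurable_fun setT f2.
  exact: (measurableT_comp (measurable_powR _) (mky y)).
have mf1' : measurable_fun setT f1.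
  apply: measurable_funM; first exact: measurableT_comp.
  exact: (measurableT_comp (measurable_powR _) (mky y)).
have := hoelder mu mf1' mf2 p0 q0 pq.
rewrite Lnorm1 [X in (X <= _)%E -> _](_ : _ = H y); last first.
  apply: eq_integral => x _ /=; congr EFin; rewrite /f1 /f2 /=.
  rewrite ger0_norm; last by rewrite !mulr_ge0 ?powR_ge0.
  by rewrite -mulrA -powRD ?pq ?powRr1// oner_eq0.
rewrite ![in X in (_ <= X)%E -> _]unlock /=.
rewrite [X in (_ <= _ * X `^ _)%E -> _](_ : _ = K%:E); last first.
  rewrite -(KE y); apply: eq_integral => x _ /=; congr EFin.
  by rewrite ger0_norm ?powR_ge0// /f2 -powRrM mulVf ?gt_eqF// powRr1.
rewrite [X in (_ <= X `^ _ * _)%E -> _](_ : _ =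
  \int[mu]_x (`|f x| `^ p * k (y - x))%:E)%E; last first.
  apply: eq_integral => x _ /=; congr EFin.
  rewrite ger0_norm; last by rewrite /f1 mulr_ge0 ?powR_ge0.
  by rewrite /f1 powRM ?powR_ge0// -powRrM mulVf// powRr1.
set J := (\int[mu]_x _)%E.
have J0 : (0 <= J)%E.
  by apply: integral_ge0 => x _; rewrite lee_fin mulr_ge0 ?powR_ge0.
move=> h.
have : (H y `^ p <= (J `^ p^-1 * (K `^ q^-1)%:E) `^ p)%E.
  apply: gt0_ler_poweR h; first exact: ltW.
    by rewrite in_itv/= leey majorant_ge0.
  by rewrite in_itv/= leey mule_ge0 ?poweR_ge0// lee_fin powR_ge0.
rewrite poweRM ?poweR_ge0 ?lee_fin ?powR_ge0// -poweRrM mulVf// poweRe1//.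
rewrite poweR_EFin -powRrM (_ : q^-1 * p = p - 1); first by rewrite muleC.
by rewrite /q; field; rewrite pm0.
Qed.

(** Young's inequality: the pointwise bound is integrated in [y] and the integrals are exchanged by
    Tonelli, which yields one more factor [K]. *)
Lemma majorant_integral :
  (\int[mu]_y (H y `^ p) <= (K `^ p)%:E * \int[mu]_x (`|f x| `^ p)%:E)%E.
Proof.
have mfp : measurable_fun setT (fun x => `|f x| `^ p).
  apply: (measurableT_comp (measurable_powR _)); exact: measurableT_comp.
have mG : measurable_fun [set: rT * rT]
    (fun z : rT * rT => (`|f z.1| `^ p * k (z.2 - z.1))%:E).
  apply/measurable_EFinP; apply: measurable_funM => //.
  apply: (measurableT_comp (measurable_powR _)); exact: measurableT_comp.
have G0 (z : rT * rT) : (0 <= (`|f z.1| `^ p * k (z.2 - z.1))%:E)%E.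
  by rewrite lee_fin mulr_ge0 ?powR_ge0.
have mI : measurable_fun setT (fun y : R => \int[mu]_x (`|f x| `^ p * k (y - x))%:E)%E.
  exact: (@measurable_fun_fubini_tonelli_G _ _ rT rT R mu _ mG G0).
have I0 (y : R) : (0 <= \int[mu]_x (`|f x| `^ p * k (y - x))%:E)%E.
  by apply: integral_ge0 => x _; exact: (G0 (x, y)).
apply: (@le_trans _ _ (\int[mu]_y ((K `^ (p - 1))%:E *
    \int[mu]_x (`|f x| `^ p * k (y - x))%:E))%E).
  apply: ge0_le_integral => //.
  - by move=> y _; exact: poweR_ge0.
  - exact: (measurableT_comp (measurable_poweR _) measurable_majorant).
  - by apply: emeasurable_funM => //.
  - by move=> y _; exact: majorant_powR.
rewrite ge0_integralZl//; last by rewrite lee_fin powR_ge0.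
have := @fubini_tonelli _ _ rT rT R mu mu _ mG G0 => /= <-.
have -> : (\int[mu]_x \int[mu]_y (`|f x| `^ p * k (y - x))%:E =
    K%:E * \int[mu]_x (`|f x| `^ p)%:E)%E.
  rewrite -ge0_integralZl//; last exact/measurable_EFinP.
  apply: eq_integral => x _.
  transitivity (\int[mu]_y ((`|f x| `^ p)%:E * (k (y - x)%R)%:E))%E.
    by apply: eq_integral => y _; rewrite -EFinM.
  rewrite ge0_integralZl//.
  - by rewrite KE2 muleC.
  - by apply/measurable_EFinP; exact: mkx.
  - by move=> y _; rewrite lee_fin.
by rewrite muleA -EFinM mulrC mulr_powRB1.
Qed.

Section Operator.
Variable q : R -> R -> R.
Hypothesis mq : measurable_fun [set: rT * rT] (fun z : rT * rT => q z.1 z.2).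
Hypothesis qk : forall x y, `|q x y| <= k (y - x).
Hypothesis fp : (\int[mu]_x (`|f x| `^ p)%:E < +oo)%E.

(** The function that represents [phi -> int f(x) (int q(x, y) phi(y) dy) dx] once the two integrals
    are exchanged. *)
Definition adjoint_kernel y := \int[mu]_x (f x * q x y).
Local Notation h := adjoint_kernel.

Let mfq : measurable_fun [set: rT * rT] (fun z : rT * rT => f z.1 * q z.1 z.2).
Proof. exact: measurable_funM. Qed.

Let mfqx (y : R) : measurable_fun setT (fun x : R => f x * q x y).
Proof. exact: (measurableT_comp mfq (measurable_pair2 y)). Qed.

Lemma measurable_adjoint : measurable_fun setT h.
Proof.
apply: (measurableT_comp (fine_measurable _)) => //.
pose Fq (z : rT * rT) := (f z.1 * q z.1 z.2)%:E.
have mFq : measurable_fun [set: rT * rT] Fq by exact/measurable_EFinP.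
(* Tonelli gives measurability in the parameter for nonnegative integrands, hence the positive and
   negative parts. *)
have -> : (fun y => \int[mu]_x (f x * q x y)%:E)%E = (fun y =>
    \int[mu]_x (Fq^\+ (x, y)) - \int[mu]_x (Fq^\- (x, y)))%E.
  apply/funext => y; rewrite integralE; congr (_ - _)%E.
    by apply: eq_integral => x _; rewrite !funeposE.
  by apply: eq_integral => x _; rewrite !funenegE.
apply: emeasurable_funB.
  apply: (@measurable_fun_fubini_tonelli_G _ _ rT rT R mu _).
    exact/measurable_funepos.
  by move=> z; exact: funepos_ge0.
apply: (@measurable_fun_fubini_tonelli_G _ _ rT rT R mu _).
  exact/measurable_funeneg.
by move=> z; exact: funeneg_ge0.
Qed.

Let le_majorant y : (\int[mu]_x `|(f x * q x y)%:E| <= H y)%E.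
Proof.
apply: ge0_le_integral => //.
- by apply: measurableT_comp => //; apply/measurable_EFinP; exact: mfqx.
- apply/measurable_EFinP; apply: measurable_funM; last exact: mky.
  exact: measurableT_comp.
- by move=> x _; rewrite lee_fin normrM ler_wpM2l.
Qed.

Lemma adjoint_le_majorant y : (`|h y|%:E <= H y)%E.
Proof.
apply: le_trans (le_majorant y).
apply: le_trans (le_abse_integral mu measurableT _); last first.
  by apply/measurable_EFinP; exact: mfqx.
(* An infinite integral is turned into 0 by [fine], which keeps the bound true. *)
by rewrite /h /Rintegral; case: (\int[mu]_x _)%E => //= *; rewrite normr0 leey.
Qed.

Lemma adjoint_integral :
  (\int[mu]_y (`|h y| `^ p)%:E <= (K `^ p)%:E * \int[mu]_x (`|f x| `^ p)%:E)%E.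
Proof.
apply: le_trans majorant_integral; apply: ge0_le_integral => //.
- apply/measurable_EFinP; apply: (measurableT_comp (measurable_powR _)).
  by apply: measurableT_comp => //; exact: measurable_adjoint.
- exact: (measurableT_comp (measurable_poweR _) measurable_majorant).
- move=> y _; rewrite -poweR_EFin; apply: gt0_ler_poweR; first exact: ltW.
  + by rewrite in_itv/= leey andbT lee_fin.
  + by rewrite in_itv/= leey andbT majorant_ge0.
  + exact: adjoint_le_majorant.
Qed.

Let le1Dpow (z : \bar R) : (0 <= z -> z <= 1 + z `^ p)%E.
Proof.
case: z => [r| |]//; last by rewrite poweRyr ?gt_eqF// addey.
rewrite lee_fin => r0; rewrite poweR_EFin lee_fin; have [r1|r1] := leP r 1.
  by rewrite (le_trans r1)// lerDl powR_ge0.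
by rewrite (le_trans (le1r_powR (ltW r1) p1))// lerDr.
Qed.

(** Fubini's theorem; the work lies in integrability on the product, which the bounded support of
    [phi] and the [L^p] bound on the majorant provide. *)
Lemma adjointE phi M : measurable_fun setT phi -> vanishes_off (- M) M phi ->
  (exists C : R, forall y, `|phi y| <= C) ->
  \int[mu]_x (f x * \int[mu]_y (q x y * phi y)) = \int[mu]_y (h y * phi y).
Proof.
move=> mphi vphi [C phiC].
pose G (z : rT * rT) := f z.1 * q z.1 z.2 * phi z.2.
have mG : measurable_fun [set: rT * rT] (EFin \o G).
  apply/measurable_EFinP; apply: measurable_funM => //.
  exact: (measurableT_comp mphi measurable_snd).
have Iphi : integ phi by exact: bounded_vanishes_off_integ vphi phiC.
have IG : (mu \x mu)%E.-integrable [set: rT * rT] (EFin \o G).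
  apply/integrable21ltyP => //.
  (* Uses [H <= 1 + H^p] and [|phi| <= C]: then [|phi| H <= |phi| + C H^p], and both terms have
     finite integral. *)
  apply: (@le_lt_trans _ _ (\int[mu]_y (`|phi y|%:E + C%:E * H y `^ p))%E).
    apply: ge0_le_integral => //.
    - by move=> y _; exact: integral_ge0.
    - apply: (@measurable_fun_fubini_tonelli_G _ _ rT rT R mu (fun z => `|(EFin \o G) z|%E)) => //.
      exact: measurableT_comp.
    - apply: emeasurable_funD; first by apply/measurable_EFinP; exact: measurableT_comp.
      apply: emeasurable_funM => //.
      exact: (measurableT_comp (measurable_poweR _) measurable_majorant).
    - move=> y _; rewrite /G /=.
      have -> : (\int[mu]_x `|(f x * q x y * phi y)%:E| =
          \int[mu]_x (`|phi y|%:E * `|(f x * q x y)%:E|))%E.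
        by apply: eq_integral => x _; rewrite /= -EFinM normrM mulrC.
      rewrite ge0_integralZl//; last first.
        by apply: measurableT_comp => //; apply/measurable_EFinP; exact: mfqx.
      apply: (@le_trans _ _ (`|phi y|%:E * (1 + H y `^ p))%E).
        rewrite lee_wpmul2l// (le_trans (le_majorant y))// le1Dpow//.
        exact: majorant_ge0.
      rewrite ge0_muleDr ?poweR_ge0// mule1 leeD2l// lee_wpmul2r ?poweR_ge0//.
      by rewrite lee_fin.
  have C0 : 0 <= C by rewrite (le_trans _ (phiC 0)).
  rewrite ge0_integralD//; last 3 first.
  - by apply/measurable_EFinP; exact: measurableT_comp.
  - by move=> y _; rewrite mule_ge0 ?poweR_ge0 ?lee_fin.
  - apply: emeasurable_funM => //.
    exact: (measurableT_comp (measurable_poweR _) measurable_majorant).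
  rewrite lte_add_pinfty//; first by have /integrableP[] := Iphi.
  rewrite ge0_integralZl//; last 2 first.
  - exact: (measurableT_comp (measurable_poweR _) measurable_majorant).
  - by move=> y _; exact: poweR_ge0.
  apply: lte_mul_pinfty => //; apply: le_lt_trans majorant_integral _.
  by apply: lte_mul_pinfty => //; rewrite lee_fin powR_ge0.
have F := @Fubini _ _ rT rT R mu mu _ IG.
have qphi x : integ (fun y => q x y * phi y).
  apply: (@integ_le _ _ (fun y => C * k (y - x))).
  - apply: measurable_funM => //.
    exact: (measurableT_comp mq (measurable_pair1 x)).
  - by move=> y; rewrite normrM mulrC ler_pM.
  - apply: integZ; have := integrable_affine (- x) (or_introl (erefl 1)) Ik.
    by under eq_fun do rewrite mul1r addrC.
have E1 x : (\int[mu]_y (EFin \o G) (x, y) = (f x * \int[mu]_y (q x y * phi y))%:E)%E.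
  rewrite -RintegralZl// /Rintegral fineK.
    by apply: eq_integral => y _; rewrite /G /= mulrA.
  exact: (integrable_fin_num _ (integZ (f x) (qphi x))).
rewrite /Rintegral; congr fine.
rewrite [LHS](_ : _ = (\int[mu]_x \int[mu]_y (EFin \o G) (x, y))%E); last first.
  by apply: eq_integral => x _; rewrite E1.
rewrite F.
apply: ae_eq_integral => //.
- exact: (@measurable_fubini_G _ _ rT rT R mu mu _ IG).
- apply/measurable_EFinP; apply: measurable_funM => //; exact: measurable_adjoint.
have := @ae_integrable2 _ _ rT rT R mu mu _ IG.
apply: filterS => y /= Iy _.
(* Fubini gives integrability of [f q phi] in [x]; that of [f q] follows on division by [phi y],
   possible only where it is nonzero. *)
have [phi0|phi0] := eqVneq (phi y) 0.
  rewrite /G /= phi0 mulr0 integral0_eq// => x _; by rewrite mulr0.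
have Ifq : integ (fun x => f x * q x y).
  have := integZ (phi y)^-1 Iy; congr (mu.-integrable setT (EFin \o _)).
  by apply/funext => x; rewrite /G /= mulrC mulfK.
rewrite /h -RintegralZr// /Rintegral fineK//.
exact: (integrable_fin_num _ Iy).
Qed.

End Operator.
End Young.
End Lp_kernel.

(** * Cutoffs and the uniqueness of weak derivatives *)

Section Cutoff.
Variable R : realType.
Implicit Types (a b l r d x : R) (f g phi chi : R -> R).

Definition cutoff l r d x := step ((x - l) / d) * step ((r - x) / d).

Lemma smooth_cutoff l r d : smooth (cutoff l r d).
Proof.
apply: smooth_mul.
  rewrite (_ : (fun x => _) = (fun x => step (- l / d + d^-1 * x))).
    by apply: smooth_affine; exact: smooth_step.
  by apply/funext => x; congr step; ring.
rewrite (_ : (fun x => _) = (fun x => step (r / d + - d^-1 * x))).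
  by apply: smooth_affine; exact: smooth_step.
by apply/funext => x; congr step; ring.
Qed.

Lemma cutoff_vanishes l r d : 0 < d -> vanishes_off l r (cutoff l r d).
Proof.
move=> d0 x; rewrite negb_and -!ltNge /cutoff => /orP[xl|rx].
  by rewrite step_eq0 ?mul0r// pmulr_lle0 ?invr_gt0// subr_le0 ltW.
by rewrite mulrC step_eq0 ?mul0r// pmulr_lle0 ?invr_gt0// subr_le0 ltW.
Qed.

Lemma cutoff_eq1 l r d x : 0 < d -> l + d <= x <= r - d -> cutoff l r d x = 1.
Proof.
move=> d0 /andP[lx xr]; rewrite /cutoff !step_eq1 ?mulr1//.
  by rewrite ler_pdivlMr// mul1r; lra.
by rewrite ler_pdivlMr// mul1r; lra.
Qed.

Lemma cutoff_ge0 l r d x : 0 <= cutoff l r d x.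
Proof. by rewrite mulr_ge0 ?step_ge0. Qed.

Lemma cutoff_le1 l r d x : cutoff l r d x <= 1.
Proof. by rewrite mulr_ile1 ?step_ge0 ?step_le1. Qed.

Lemma test_setT_derive1n phi k :
  test_function setT phi -> test_function setT (derive1n k phi).
Proof.
move=> /test_functionTP[sp [M vM]]; apply/test_functionTP; split.
  exact: smooth_derive1n.
by exists M; exact: vanishes_off_derive1n.
Qed.

Lemma test_setT_derive1 phi :
  test_function setT phi -> test_function setT (derive1 phi).
Proof. exact: (@test_setT_derive1n phi 1). Qed.

Lemma test_itv_mul a b chi f : a < b -> test_function `]a, b[%classic chi ->
  smooth f -> test_function `]a, b[%classic (chi \* f).
Proof.
move=> ab /(test_function_itvP _ ab)[sc [c [d [ac cd db vf]]]] sf.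
apply/(test_function_itvP _ ab); split; first exact: smooth_mul.
by exists c, d; split=> // x xcd; rewrite /= vf// mul0r.
Qed.

Lemma test_itv_derive1 a b chi : a < b -> test_function `]a, b[%classic chi ->
  test_function `]a, b[%classic (derive1 chi).
Proof.
move=> ab /(test_function_itvP _ ab)[sc [c [d [ac cd db vf]]]].
apply/(test_function_itvP _ ab); split; first exact: smooth_derive1.
by exists c, d; split=> //; exact: (@vanishes_off_derive1n R c d chi 1).
Qed.

Lemma test_setT_bounded phi : test_function setT phi ->
  exists2 C : R, 0 <= C & forall x, `|phi x| <= C.
Proof.
move=> /test_functionTP[sp [M vM]].
exact: vanishes_off_continuous_bounded (smooth_continuous sp) vM.
Qed.

Lemma test_itv_setT a b chi : a < b -> test_function `]a, b[%classic chi ->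
  test_function setT chi.
Proof. by move=> _ [sc [cc _]]; split=> //; split. Qed.

End Cutoff.

Section Du_Bois_Reymond.
Variable R : realType.
Local Notation mu := (@lebesgue_measure R).
Local Notation integ f := (mu.-integrable setT (EFin \o f)).
Implicit Types (a b l r d x M : R) (f g phi w : R -> R).

Lemma ae_imp (P Q : R -> Prop) : (forall x, P x -> Q x) ->
  {ae mu, forall x, P x} -> {ae mu, forall x, Q x}.
Proof.
move=> PQ; apply: (@filterS _ _ _ P Q PQ).
exact: (@ae_filter_ringOfSetsType _ (measurableTypeR R) R mu).
Qed.

Lemma locally_integrable_integ w M : locally_integrable setT w ->
  mu.-integrable `[- M, M] (EFin \o w).
Proof.
move=> [mw _ wK]; apply/integrableP; split.
  by apply/measurable_EFinP; exact: measurable_funTS.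
by apply: wK => //; exact: segment_compact.
Qed.

Lemma locally_integrable_mul w g M : locally_integrable setT w ->
  measurable_fun setT g -> vanishes_off (- M) M g ->
  (exists C : R, forall x, `|g x| <= C) -> integ (fun x => w x * g x).
Proof.
move=> lw mg vg [C gC]; have [mw _ _] := lw.
have C0 : 0 <= C by rewrite (le_trans _ (gC 0)).
have Iw : integ (w \_ `[- M, M]).
  have := locally_integrable_integ M lw.
  by rewrite integrable_mkcond ?restrict_EFin//; exact: measurable_itv.
apply: (@integ_le _ _ (fun x => C * `|(w \_ `[- M, M]) x|)).
- exact: measurable_funM.
- move=> x; rewrite patchE; case: ifPn => [_|].
    by rewrite normrM mulrC ler_wpM2r.
  rewrite notin_setE /= in_itv/= => /negP /vg ->.
  by rewrite mulr0 !normr0 mulr0.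
- by apply: integZ; exact: integ_norm.
Qed.

Lemma integ_test_mul w phi : locally_integrable setT w ->
  test_function setT phi -> integ (fun x => w x * phi x).
Proof.
move=> lw tp; have [C _ pC] := test_setT_bounded tp.
move/test_functionTP: tp => [sp [M vM]].
apply: (locally_integrable_mul lw (smooth_measurable sp) vM).
by exists C.
Qed.

Lemma cutoff_cvg l r x : l < r ->
  cutoff l r n.+1%:R^-1 x @[n --> \oo] --> (\1_`]l, r[%classic x : R).
Proof.
move=> lr; rewrite indicE; case: (boolP (x \in _)); last first.
  rewrite notin_setE /= in_itv/= => /negP; rewrite negb_and -!leNgt => xlr.
  apply: cvg_near_cst; apply: nearW => n /=.
  rewrite /cutoff; case/orP: xlr => h.
    by rewrite step_eq0 ?mul0r// pmulr_lle0 ?subr_le0// invr_gt0 invr_gt0.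
  by rewrite mulrC step_eq0 ?mul0r// pmulr_lle0 ?subr_le0// invr_gt0 invr_gt0.
rewrite inE /= in_itv/= => /andP[lx xr].
have e0 : 0 < Num.min (x - l) (r - x) by rewrite lt_min !subr_gt0 lx xr.
apply: cvg_near_cst; near=> n.
have : n.+1%:R^-1 < Num.min (x - l) (r - x).
  near: n; exact: near_infty_natSinv_lt (PosNum e0).
rewrite lt_min; have : 0 < n.+1%:R^-1 :> R by rewrite invr_gt0.
move: (n.+1%:R^-1) => e e1 /andP[h1 h2]; apply: cutoff_eq1 => //.
by apply/andP; split; lra.
Unshelve. all: by end_near. Qed.

(** The cutoffs with ramps of width [1/(n+1)] tend to the indicator of the open interval and stay
    between 0 and 1; dominated convergence carries the hypothesis over to it. *)
Lemma Rintegral_itv_eq0 w l r : l < r -> locally_integrable setT w ->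
  (forall phi, test_function setT phi -> \int[mu]_x (w x * phi x) = 0) ->
  \int[mu]_(x in `]l, r[) w x = 0.
Proof.
move=> lr lw h; have [mw _ _] := lw.
pose M := `|l| + `|r|.
have lM : - M <= l by have := ler_norm (- l); rewrite normrN /M; have := normr_ge0 r; lra.
have rM : r <= M by have := ler_norm r; rewrite /M; have := normr_ge0 l; lra.
pose f (n : nat) x := (w x * cutoff l r n.+1%:R^-1 x)%:E.
pose g := fun x => `|(w \_ `[- M, M]) x|%:E.
have Iw : integ (w \_ `[- M, M]).
  have := locally_integrable_integ M lw.
  by rewrite integrable_mkcond ?restrict_EFin//; exact: measurable_itv.
have mf n : measurable_fun setT (f n).
  apply/measurable_EFinP; apply: measurable_funM => //.
  by apply: smooth_measurable; exact: smooth_cutoff.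
have m1 : measurable_fun setT (fun x => (w x * \1_`]l, r[%classic x)%:E).
  by apply/measurable_EFinP; apply: measurable_funM.
have cM (n : nat) : vanishes_off (- M) M (cutoff l r n.+1%:R^-1).
  by apply: vanishes_off_ler lM rM _; apply: cutoff_vanishes; rewrite invr_gt0.
have cvf : {ae mu, forall x, setT x -> f ^~ x @ \oo --> (w x * \1_`]l, r[%classic x)%:E}.
  apply: aeW => x _; apply: cvg_EFin; first exact: nearW.
  by apply: cvgM; [exact: cvg_cst|exact: cutoff_cvg].
have dom : {ae mu, forall x n, setT x -> (`|f n x| <= g x)%E}.
  apply: aeW => x n _; rewrite lee_fin patchE; case: ifPn => [_|].
    rewrite normrM [`|cutoff _ _ _ _|]ger0_norm ?cutoff_ge0//.
    by rewrite ler_piMr// cutoff_le1.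
  rewrite notin_setE /= in_itv/= => /negP xM.
  by rewrite cM// ?mulr0 ?normr0.
have [_ _] := @dominated_convergence _ (measurableTypeR R) R mu setT measurableT f
  _ g mf m1 cvf (integ_norm Iw) dom.
rewrite (_ : [sequence _]_n = cst 0%E); last first.
  apply/funext => n /=.
  have tn : test_function setT (cutoff l r n.+1%:R^-1).
    apply/test_functionTP; split; first exact: smooth_cutoff.
    by exists M; exact: cM.
  have := h _ tn; rewrite /Rintegral => h0.
  rewrite -[LHS]fineK ?h0//; exact: (integrable_fin_num _ (integ_test_mul lw tn)).
move=> /cvg_unique -/(_ _ _ (cvg_cst _)) E.
rewrite Rintegral_mkcond /Rintegral (_ : (\int[mu]_x _)%E = 0%E)//.
rewrite -[RHS]E//; apply: eq_integral => x _; rewrite patchE indicE.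
by case: ifPn; rewrite ?mulr1 ?mulr0.
Qed.

(** The integral of [w] over every interval is 0, so its indefinite integrals are constant; by
    Lebesgue differentiation their derivative is also [w] almost everywhere. *)
Lemma du_bois_reymond w : locally_integrable setT w ->
  (forall phi, test_function setT phi -> \int[mu]_x (w x * phi x) = 0) ->
  {ae mu, forall x, w x = 0}.
Proof.
move=> lw h; have [mw _ _] := lw.
(* Truncation to [[- n, n]] makes [w] integrable; the countably many exceptional null sets are then
   united. *)
suff : {ae mu, forall x, forall n : nat, - n%:R < x < n%:R -> w x = 0}.
  apply: ae_imp => x wx; apply: (wx (Num.truncn `|x|).+1).
  by rewrite -ltr_norml truncnS_gt.
apply: ae_foralln => n.
pose wn := w \_ `[- n%:R, n%:R].
have Iwn : integ wn.
  have := locally_integrable_integ n%:R lw.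
  by rewrite integrable_mkcond ?restrict_EFin//; exact: measurable_itv.
have lwn : locally_integrable setT wn.
  by apply: open_integrable_locally => //; exact: openT.
have := @FTC1 R wn (BLeft (- n%:R)) _ lwn.
have Iy (y : R) : mu.-integrable [set` Interval (BLeft (- n%:R)) (BRight y)] (EFin \o wn).
  by apply: integrableS Iwn => //; exact: measurable_itv.
move=> /(_ Iy); apply: ae_imp => x Fx /andP[nx xn].
have [|_] := Fx; first by rewrite (@lte_fin R).
rewrite (@eq_on_derive1 R `]- n%:R, n%:R[%classic _ (cst 0)).
- rewrite derive1_cst /wn patchE mem_set//= in_itv/= (ltW nx) (ltW xn)//.
- exact: interval_open.
- by rewrite /= in_itv/= nx.
move=> y /=; rewrite in_itv/= => /andP[ny yn].
rewrite -Rintegral_itv_bndo_bndc; last by apply: integrableS Iwn => //; exact: measurable_itv.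
rewrite -Rintegral_itv_obnd_cbnd; last by apply: integrableS Iwn => //; exact: measurable_itv.
rewrite -[RHS](Rintegral_itv_eq0 ny lw h); apply: eq_Rintegral => z.
rewrite inE /= in_itv/= => /andP[nz zy].
by rewrite /wn patchE mem_set//= in_itv/= (ltW nz) (ltW (lt_trans zy yn)).
Qed.

(** Used to transfer norm bounds from constructed weak derivatives to the chosen ones that define
    the Sobolev norms. *)
Lemma weak_unique w1 w2 : locally_integrable setT w1 -> locally_integrable setT w2 ->
  (forall phi, test_function setT phi ->
    \int[mu]_x (w1 x * phi x) = \int[mu]_x (w2 x * phi x)) ->
  {ae mu, forall x, w1 x = w2 x}.
Proof.
move=> l1 l2 h; have := du_bois_reymond (locally_integrableB l1 l2).
move=> H; have : {ae mu, forall x, (w1 \- w2) x = 0}.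
  apply: H => phi tp; have := h _ tp; move/eqP; rewrite -subr_eq0 => /eqP <-.
  rewrite -RintegralB//; [|exact: integ_test_mul|exact: integ_test_mul].
  by apply: eq_Rintegral => x _; rewrite /= mulrBl.
by apply: ae_imp => x /= /eqP; rewrite subr_eq0 => /eqP.
Qed.

End Du_Bois_Reymond.

(** * Functionals represented by Lp functions *)

Section Representation.
Variable R : realType.
Local Notation mu := (@lebesgue_measure R).
Local Notation integ f := (mu.-integrable setT (EFin \o f)).
Local Notation rT := (measurableTypeR R).
Implicit Types (a b c M : R) (f g h k phi psi chi w : R -> R) (L : (R -> R) -> R).
Variable p : R.
Hypothesis p1 : 1 <= p.

Let p0 : 0 < p. Proof. exact: lt_le_trans p1. Qed.

(** The inequality [|f| <= 1 + |f|^p] takes the place of Hoelder and treats all [p >= 1] alike. *)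
Lemma in_Lp_integ f g M C : in_Lp p f -> measurable_fun setT g ->
  vanishes_off (- M) M g -> (forall x, `|g x| <= C) ->
  integ (fun x => f x * g x).
Proof.
move=> [mf fp] mg vg gC; have C0 : 0 <= C by rewrite (le_trans _ (gC 0)).
have Ifp : integ (fun x => `|f x| `^ p).
  apply/integrableP; split.
    apply/measurable_EFinP; apply: (measurableT_comp (measurable_powR _)).
    exact: measurableT_comp.
  by under eq_integral do rewrite /= ger0_norm ?powR_ge0//.
apply: (@integ_le _ _ (fun x => C * (\1_(`[- M, M]%classic) x + `|f x| `^ p))).
- exact: measurable_funM.
- move=> x; have [xM|xM] := boolP (- M <= x <= M); last first.
    by rewrite vg// mulr0 normr0 mulr_ge0// addr_ge0 ?powR_ge0.
  rewrite indicE mem_set/= ?in_itv//= normrM mulrC ler_pM//.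
  have [r1|r1] := leP `|f x| 1; first by rewrite (le_trans r1)// lerDl powR_ge0.
  by rewrite (le_trans (le1r_powR (ltW r1) p1))// lerDr.
- by apply: integZ; apply: integD => //; exact: integrable_indic_itv.
Qed.

Lemma in_Lp_test_integ f phi : in_Lp p f -> test_function setT phi ->
  integ (fun x => f x * phi x).
Proof.
move=> fp tp; have [C _ pC] := test_setT_bounded tp.
move/test_functionTP: tp => [sp [M vM]].
exact: (in_Lp_integ fp (smooth_measurable sp) vM pC).
Qed.

Lemma in_Lp_locally_integrable f : in_Lp p f -> locally_integrable setT f.
Proof.
move=> fp; have [mf _] := fp; split => //; first exact: openT.
move=> K _ cK; have [M [_ hM]] := compact_bounded cK.
have KM : K `<=` `[- (M + 1), M + 1]%classic.
  by move=> x Kx; rewrite /= in_itv/= -ler_norml; apply: hM => //; rewrite ltrDl.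
have mK := compact_measurable cK.
have : integ (fun x => f x * \1_K x).
  apply: (@in_Lp_integ _ _ (M + 1) 1) => //.
    move=> x xM; rewrite indicE memNset// => /KM /=.
    by rewrite in_itv/= (negbTE xM).
  by move=> x; rewrite indicE ger0_norm// lern1 leq_b1.
move=> /integrableP[_]; apply: le_lt_trans.
rewrite integral_mkcond; apply: ge0_le_integral => //.
- by move=> x _; rewrite patchE; case: ifPn.
- apply/(measurable_restrictT _ mK).
  by apply/measurable_EFinP; apply: measurableT_comp => //; exact: measurable_funTS.
- by apply/measurable_EFinP; apply: measurableT_comp => //; exact: measurable_funM.
- move=> x _; rewrite patchE /= indicE; by case: (x \in K); rewrite /= ?mulr1 ?mulr0 ?normr0.
Qed.

Lemma Lp_norm_ge0 f : (0 <= Lp_norm p setT f)%E.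
Proof. exact: Lnorm_ge0. Qed.

Lemma ae_eq_Lp_norm f g : measurable_fun setT f -> measurable_fun setT g ->
  {ae mu, forall x, f x = g x} -> Lp_norm p setT f = Lp_norm p setT g.
Proof.
move=> mf mg fg; rewrite !Lp_norm_setT.
have mp (u : R -> R) : measurable_fun setT u ->
    measurable_fun setT (fun x => (`|u x| `^ p)%:E).
  move=> mu_; apply/measurable_EFinP; apply: (measurableT_comp (measurable_powR _)).
  exact: measurableT_comp.
have -> : (\int[mu]_x (`|f x| `^ p)%:E = \int[mu]_x (`|g x| `^ p)%:E)%E; last by [].
apply: ae_eq_integral => //; [exact: mp|exact: mp|].
by apply: ae_imp fg => x -> _.
Qed.

Lemma in_Lp_mul f chi (N C : R) : in_Lp p f -> (Lp_norm p setT f <= N%:E)%E ->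
  measurable_fun setT chi -> (forall x, `|chi x| <= C) ->
  in_Lp p (chi \* f) /\ (Lp_norm p setT (chi \* f)%R <= (C * N)%:E)%E.
Proof.
move=> [mf fp] fN mc cC; have C0 : 0 <= C by rewrite (le_trans _ (cC 0)).
have N0 : 0 <= N by rewrite -lee_fin (le_trans (Lp_norm_ge0 f)).
have mp (u : R -> R) : measurable_fun setT u ->
    measurable_fun setT (fun x => (`|u x| `^ p)%:E).
  move=> mu_; apply/measurable_EFinP; apply: (measurableT_comp (measurable_powR _)).
  exact: measurableT_comp.
have le : (\int[mu]_x (`|chi x * f x| `^ p)%:E <=
    (C `^ p)%:E * \int[mu]_x (`|f x| `^ p)%:E)%E.
  rewrite -ge0_integralZl//; last 2 first.
  - exact: mp.
  - by rewrite lee_fin powR_ge0.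
  apply: ge0_le_integral => //.
  - by apply: mp; exact: measurable_funM.
  - by apply: emeasurable_funM => //; exact: mp.
  - move=> x _; rewrite -EFinM lee_fin /= normrM powRM// ler_wpM2r ?powR_ge0//.
    by apply: ge0_ler_powR; rewrite ?nnegrE// ltW.
split.
  split; first exact: measurable_funM.
  apply: le_lt_trans le _; apply: lte_mul_pinfty => //.
  by rewrite lee_fin powR_ge0.
apply: Lp_norm_le => //; first exact: mulr_ge0.
apply: (le_trans le); rewrite powRM// EFinM lee_wpmul2l ?lee_fin ?powR_ge0//.
rewrite -poweR_Lp_norm// -poweR_EFin; apply: gt0_ler_poweR => //.
- exact: ltW.
- by rewrite in_itv/= leey Lp_norm_ge0.
- by rewrite in_itv/= leey andbT lee_fin.
Qed.

Lemma in_LpD f g (A B : R) : in_Lp p f -> in_Lp p g ->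
  (Lp_norm p setT f <= A%:E)%E -> (Lp_norm p setT g <= B%:E)%E ->
  in_Lp p (f \+ g) /\ (Lp_norm p setT (f \+ g)%R <= (A + B)%:E)%E.
Proof.
move=> fp gp fA gB; split.
  apply/(in_LpP _ p1)/Lp_setT.
  move/(in_LpP _ p1)/Lp_setT: fp => fp; move/(in_LpP _ p1)/Lp_setT: gp => gp.
  have p1' : (1 <= p%:E)%E by rewrite lee_fin.
  exact: (proj2 (Lfun_addr_closed mu p1')).
have [mf _] := fp; have [mg _] := gp.
rewrite /Lp_norm !patch_setT in fA gB *.
have := minkowski_EFin mu mf mg p1; move=> /le_trans; apply.
by rewrite EFinD leeD.
Qed.

(** The functional is given by an [L^p] function of norm at most [B], on all test functions of the
    line. Weak derivatives, integer and fractional, are functionals of this kind, so existence and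
    bound are obtained together. *)
Definition rep L (B : R) := exists h, [/\ in_Lp p h,
  (Lp_norm p setT h <= B%:E)%E &
  forall phi, test_function setT phi -> L phi = \int[mu]_x (h x * phi x)].

Lemma rep_ext L1 L2 B :
  (forall phi, test_function setT phi -> L2 phi = L1 phi) -> rep L1 B -> rep L2 B.
Proof.
by move=> E [h [h1 h2 h3]]; exists h; split=> // phi tp; rewrite E// h3.
Qed.

Lemma rep_le L A B : A <= B -> rep L A -> rep L B.
Proof.
move=> AB [h [h1 h2 h3]]; exists h; split=> //.
by rewrite (le_trans h2)// lee_fin.
Qed.

Lemma repD L1 L2 A B : rep L1 A -> rep L2 B ->
  rep (fun phi => L1 phi + L2 phi) (A + B).
Proof.
move=> [h [h1 h2 h3]] [g [g1 g2 g3]]; exists (h \+ g).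
have [i1 i2] := in_LpD h1 g1 h2 g2; split=> // phi tp.
rewrite h3// g3// -RintegralD//; [|exact: in_Lp_test_integ..].
by apply: eq_Rintegral => x _; rewrite /= mulrDl.
Qed.

Lemma repZ L B c : rep L B -> rep (fun phi => c * L phi) (`|c| * B).
Proof.
move=> [h [h1 h2 h3]]; exists (cst c \* h).
have [i1 i2] := in_Lp_mul h1 h2 (@measurable_cst _ _ _ _ setT c) (fun=> lexx `|c|).
split=> // phi tp; rewrite h3// -RintegralZl//; last exact: in_Lp_test_integ.
by apply: eq_Rintegral => x _; rewrite /= mulrA.
Qed.

Lemma repN L B : rep L B -> rep (fun phi => - L phi) B.
Proof.
move=> /(@repZ _ _ (-1)); rewrite normrN normr1 mul1r.
by apply: rep_ext => phi _; rewrite mulN1r.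
Qed.

Lemma repB L1 L2 A B : rep L1 A -> rep L2 B ->
  rep (fun phi => L1 phi - L2 phi) (A + B).
Proof. by move=> r1 r2; apply: repD => //; exact: repN. Qed.

Lemma rep_mul f chi (N C : R) : in_Lp p f -> (Lp_norm p setT f <= N%:E)%E ->
  measurable_fun setT chi -> (forall x, `|chi x| <= C) ->
  rep (fun phi => \int[mu]_x (chi x * f x * phi x)) (C * N).
Proof.
move=> fp fN mc cC; have [h1 h2] := in_Lp_mul fp fN mc cC.
by exists (chi \* f); split.
Qed.

(** Young's inequality in dual form: the operator with kernel [q] acts on the test function, and its
    transpose acts on [f]. *)
Lemma rep_kernel f (q : R -> R -> R) k (N : R) : in_Lp p f -> (Lp_norm p setT f <= N%:E)%E ->
  integ k -> (forall s, 0 <= k s) ->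
  measurable_fun [set: rT * rT] (fun z : rT * rT => q z.1 z.2) ->
  (forall x y, `|q x y| <= k (y - x)) ->
  rep (fun phi => \int[mu]_x (f x * \int[mu]_y (q x y * phi y)))
    (\int[mu]_s k s * N).
Proof.
move=> [mf fp] fN Ik k0 mq qk.
have K0 : 0 <= \int[mu]_s k s by exact: Rintegral_ge0.
have N0 : 0 <= N by rewrite -lee_fin (le_trans (Lp_norm_ge0 f)).
have le := adjoint_integral p1 mf Ik k0 mq qk.
exists (adjoint_kernel f q); split.
- split; first exact: (measurable_adjoint mf mq).
  apply: le_lt_trans le _; apply: lte_mul_pinfty => //.
  by rewrite lee_fin powR_ge0.
- apply: Lp_norm_le => //; first exact: mulr_ge0.
  apply: (le_trans le); rewrite powRM// EFinM lee_wpmul2l ?lee_fin ?powR_ge0//.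
  rewrite -poweR_Lp_norm// -poweR_EFin; apply: gt0_ler_poweR => //.
  + exact: ltW.
  + by rewrite in_itv/= leey Lp_norm_ge0.
  + by rewrite in_itv/= leey andbT lee_fin.
- move=> phi tp; have [C _ pC] := test_setT_bounded tp.
  move/test_functionTP: tp => [sp [M vM]].
  apply: (adjointE p1 mf Ik k0 mq qk fp (smooth_measurable sp) vM).
  by exists C.
Qed.

End Representation.

(** * Successive weak derivatives and their products with a cutoff *)

Section Chain.
Variable R : realType.
Local Notation mu := (@lebesgue_measure R).
Local Notation integ f := (mu.-integrable setT (EFin \o f)).
Implicit Types (c M N : R) (f g h phi psi chi w : R -> R) (m i j k : nat).
Variables (p a b : R).
Hypotheses (p1 : 1 <= p) (ab : a < b).
Local Notation testO := (test_function `]a, b[%classic).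

(** Models the zero extensions of [u] and its weak derivatives: consecutive terms are linked by one
    integration by parts, valid only against test functions on the interval, and [N] bounds all the
    norms at once. *)
Definition chain m (v : nat -> R -> R) N :=
  [/\ forall i, (i <= m)%N -> in_Lp p (v i),
      forall i, (i <= m)%N -> (Lp_norm p setT (v i) <= N%:E)%E,
      forall i, (i <= m)%N -> vanishes_off a b (v i) &
      forall i phi, (i < m)%N -> testO phi ->
        \int[mu]_x (v i.+1 x * phi x) = - \int[mu]_x (v i x * derive1 phi x)].

(** Here [g] need not have bounded support, as is the case for a fractional derivative of a test
    function; the support of [v] makes up for it. *)
Lemma integ_vanishing v g : in_Lp p v -> vanishes_off a b v -> continuous g ->
  integ (fun x => v x * g x).
Proof.
move=> vp vab cg; pose M := `|a| + `|b|.
have aM : - M <= a by have := ler_norm (- a); rewrite normrN /M; have := normr_ge0 b; lra.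
have bM : b <= M by have := ler_norm b; rewrite /M; have := normr_ge0 a; lra.
have [C C0 gC] := continuous_bounded_on cg M.
have mg := continuous_measurable_fun cg.
have -> : (fun x => v x * g x) = (fun x => v x * (g x * \1_(`[- M, M]%classic) x)).
  apply/funext => x; have [xM|xM] := boolP (- M <= x <= M).
    by rewrite indicE mem_set/= ?in_itv//= mulr1.
  by rewrite (vanishes_off_ler aM bM vab)// !mul0r.
apply: (@in_Lp_integ _ _ p1 _ _ M C) => //.
- by apply: measurable_funM.
- by move=> x xM; rewrite indicE memNset ?mulr0//= in_itv/= (negbTE xM).
move=> x; have [xM|xM] := boolP (- M <= x <= M).
  by rewrite indicE mem_set/= ?in_itv//= mulr1; apply: gC; rewrite ler_norml.
by rewrite indicE memNset ?mulr0 ?normr0//= in_itv/= (negbTE xM).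
Qed.

Lemma chain_ge0 m v N : chain m v N -> 0 <= N.
Proof.
by move=> [_ h _ _]; rewrite -lee_fin (le_trans (Lp_norm_ge0 p (v 0%N)))// h.
Qed.

Lemma chain_iter m v N i k phi : chain m v N -> (i + k <= m)%N -> testO phi ->
  \int[mu]_x (v (i + k)%N x * phi x) =
  (-1) ^+ k * \int[mu]_x (v i x * derive1n k phi x).
Proof.
move=> [_ _ _ h]; elim: k phi => [|k ih] phi ikm tp.
  by rewrite addn0 mul1r.
rewrite addnS h//; last by rewrite -addnS.
rewrite ih; last 2 first.
- by rewrite (leq_trans _ ikm)// leq_add2l.
- exact: test_itv_derive1.
by rewrite exprS mulN1r mulNr derive1nSr.
Qed.

Lemma test_itv_smooth chi : testO chi -> smooth chi.
Proof. by case. Qed.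

Lemma test_itv_integ v chi f : in_Lp p v -> testO chi -> smooth f ->
  integ (fun x => v x * (chi x * f x)).
Proof.
move=> vp tc sf; apply: (in_Lp_test_integ p1 vp (phi := chi \* f)).
exact: test_itv_setT ab (test_itv_mul ab tc sf).
Qed.

(** The product [chi f] is a test function on the interval even if [f] is not supported there; the
    product rule then isolates the term with [f']. *)
Lemma chain_mul m v N i chi f : chain m v N -> (i < m)%N -> testO chi ->
  smooth f ->
  \int[mu]_x (chi x * v i x * derive1 f x) =
  (- \int[mu]_x (chi x * v i.+1 x * f x)) - \int[mu]_x (derive1 chi x * v i x * f x).
Proof.
move=> [vp _ _ h] im tc sf; have sc := test_itv_smooth tc.
have im' := ltnW im.
have := h i (chi \* f) im (test_itv_mul ab tc sf).
have -> : \int[mu]_x (v i x * derive1 (chi \* f) x) =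
   \int[mu]_x (derive1 chi x * v i x * f x) + \int[mu]_x (chi x * v i x * derive1 f x).
  rewrite -RintegralD//.
  - apply: eq_Rintegral => x _; rewrite derive1M; [ring| |];
    exact: smooth_derivable.
  - have := test_itv_integ (vp _ im') (test_itv_derive1 ab tc) sf.
    by congr (mu.-integrable setT (EFin \o _)); apply/funext => x; ring.
  - have := test_itv_integ (vp _ im') tc (smooth_derive1 sf).
    by congr (mu.-integrable setT (EFin \o _)); apply/funext => x; ring.
have -> : \int[mu]_x (chi x * v i.+1 x * f x) = \int[mu]_x (v i.+1 x * (chi \* f) x).
  by apply: eq_Rintegral => x _ /=; ring.
by move=> ->; ring.
Qed.

(** Each integration by parts moves a derivative either to [v], raising its index, or to [chi]; the
    induction is therefore over all cutoffs. The constant depends on [chi] and [k] alone. *)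
Lemma deriv_rep k chi : testO chi -> exists2 C : R, 0 <= C &
  forall m v N i, chain m v N -> (i + k <= m)%N ->
  rep p (fun phi => \int[mu]_x (chi x * v i x * derive1n k phi x)) (C * N).
Proof.
elim: k chi => [|k ih] chi tc.
  have [C C0 cC] := test_setT_bounded (test_itv_setT ab tc).
  exists C => // m v N i [vp vN _ _] im; rewrite addn0 in im.
  apply: rep_mul => //; [exact: vp|exact: vN|].
  exact: smooth_measurable (test_itv_smooth tc).
have [C C0 hC] := ih _ tc; have [D D0 hD] := ih _ (test_itv_derive1 ab tc).
exists (C + D); first exact: addr_ge0.
move=> m v N i cv im; rewrite mulrDl.
have ikm : (i + k <= m)%N by rewrite (leq_trans _ im)// leq_add2l.
have iSkm : (i.+1 + k <= m)%N by rewrite addSnnS.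
have i_m : (i < m)%N by rewrite (leq_trans _ iSkm)// leq_addr.
apply: rep_ext (repB p1 (repN p1 (hC _ _ _ _ cv iSkm)) (hD _ _ _ _ cv ikm)).
move=> phi [sp _]; rewrite derive1nS (chain_mul cv i_m tc)//.
exact: smooth_derive1n.
Qed.

End Chain.

(** * The kernel of the fractional derivative *)

Section Kernels.
Variable R : realType.
Local Notation mu := (@lebesgue_measure R).
Local Notation integ f := (mu.-integrable setT (EFin \o f)).
Local Notation rT := (measurableTypeR R).
Implicit Types (c s t x y : R) (f g h phi chi : R -> R) (j k : nat).

Lemma derive1n_cst0 k : derive1n k (cst (0 : R)) = cst 0.
Proof.
by elim: k => [//|k ih]; rewrite derive1nS ih; apply/funext => x; rewrite derive1_cst.
Qed.

Lemma open_gt0 : open (`]0, +oo[%classic : set R).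
Proof. exact: interval_open. Qed.

Lemma Dn_powR k c : Dn k (`]0, +oo[%classic : set R) (fun t => t `^ c).
Proof.
have dp c' t : `]0, +oo[%classic t -> 
    is_derive t (1 : R) (fun u : R => u `^ c') (c' * t `^ (c' - 1)).
  by rewrite /= in_itv/= andbT => t0; exact: is_derive1_powR.
elim: k c => [|k ih] c; first by apply: Dn0 => t t0; case: (dp c t t0).
apply/DnS; split; first by move=> t t0; case: (dp c t t0).
apply: (@eq_on_Dn _ _ _ (cst c \* (fun t => t `^ (c - 1)))).
- exact: open_gt0.
- by move=> t t0; rewrite derive1E; have [_ ->] := dp c t t0.
- by apply: (Dn_mul open_gt0 (@Dn_cst _ _ _ _) (ih _)).
Qed.

Lemma derive1n_powR k c : exists C : R, forall t, 0 < t ->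
  derive1n k (fun u : R => u `^ c) t = C * t `^ (c - k%:R).
Proof.
elim: k => [|k [C ih]]; first by exists 1 => t _; rewrite mul1r subr0.
exists (C * (c - k%:R)) => t t0; rewrite derive1nS.
rewrite (@eq_on_derive1 R `]0, +oo[%classic _ (fun u => C * u `^ (c - k%:R))).
- have dp : is_derive t (1 : R) (fun u : R => u `^ (c - k%:R)) _ := is_derive1_powR _ t0.
  case: dp => dp1 dp2.
  rewrite derive1Ml// derive1E dp2 mulrA; congr (_ * _ `^ _).
  by rewrite -natr1; ring.
- exact: open_gt0.
- by rewrite /= in_itv/= t0.
- by move=> u; rewrite /= in_itv/= andbT => /ih.
Qed.

Variables (e d alpha : R).
Hypotheses (e1 : e = 1 \/ e = -1) (d0 : 0 < d) (a0 : 0 < alpha).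
Let m := Num.truncn alpha.
Let n := m.+1.
Let beta := n%:R - alpha.

Let beta_gt0 : 0 < beta.
Proof. by rewrite subr_gt0; exact: truncnS_gt. Qed.

Let e_neq0 : e != 0.
Proof. by case: e1 => ->; rewrite ?oner_neq0// oppr_eq0 oner_neq0. Qed.

Let norm_e x : `|e * x| = `|x|.
Proof. by case: e1 => ->; rewrite ?mul1r// mulN1r normrN. Qed.

Definition theta t := step (2 + (- (2 / d)) * t).

Lemma smooth_theta : smooth theta.
Proof. by apply: smooth_affine; exact: smooth_step. Qed.

Lemma theta_eq1 t : t <= d / 2 -> theta t = 1.
Proof.
move=> td; rewrite /theta step_eq1//.
have : 2 / d * t <= 1 by rewrite mulrAC ler_pdivrMr// mul1r; lra.
by rewrite mulNr; lra.
Qed.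

Lemma theta_eq0 t : d <= t -> theta t = 0.
Proof.
move=> td; rewrite /theta step_eq0//.
have : 2 <= 2 / d * t by rewrite mulrAC ler_pdivlMr//; lra.
by rewrite mulNr; lra.
Qed.

(** The sign [e] is 1 for the right derivative and -1 for the left one. Both are then integrals of
    [phi y * ker (y - z)] over the whole line, and a single argument serves both. *)
Definition ker s := if 0 < e * s then (e * s) `^ (beta - 1) else 0.
Definition ker0 s :=
  if 0 < e * s then (e * s) `^ (beta - 1) * theta (e * s) else 0.
Definition tail t := if 0 < t then t `^ (beta - 1) * (1 - theta t) else 0.
Definition ker1 s := tail (0 + e * s).
Definition kappa := derive1n n ker1.

Lemma kerE s : ker s = ker0 s + ker1 s.
Proof.
by rewrite /ker /ker0 /ker1 /tail add0r; case: ifP => _; [ring|rewrite addr0].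
Qed.

(** The half-lines [t > 0] and [t < d/2] cover the line: on the first [tail] is a product of smooth
    functions, on the second it is 0. *)
Lemma smooth_tail : smooth tail.
Proof.
apply/smoothE => k.
rewrite (_ : setT = `]0, +oo[%classic `|` `]-oo, (d / 2)[%classic); last first.
  apply/seteqP; split=> // t _; rewrite /= !in_itv/= andbT.
  by have [t0|t0] := ltP 0 t; [left|right; rewrite (le_lt_trans t0)// divr_gt0].
apply: Dn_setU.
  apply: (@eq_on_Dn _ _ _ ((fun t => t `^ (beta - 1)) \*
      (cst 1 \+ (fun t => - theta t)))).
  - exact: open_gt0.
  - by move=> t; rewrite /= in_itv/= andbT /tail => ->.
  - apply: (Dn_mul open_gt0); first exact: Dn_powR.
    apply: (Dn_add open_gt0); first exact: Dn_cst.
    apply: (@subset_Dn _ _ _ setT) => //.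
    by move: k; apply/smoothE; apply: smooth_opp; exact: smooth_theta.
apply: (@eq_on_Dn _ _ _ (cst 0)).
- exact: interval_open.
- move=> t; rewrite /= in_itv/= /tail => td; case: ifP => // _.
  by rewrite theta_eq1 ?subrr ?mulr0// ltW.
- exact: Dn_cst.
Qed.

Lemma smooth_ker1 : smooth ker1.
Proof. exact: smooth_affine smooth_tail. Qed.

Lemma measurable_theta : measurable_fun setT theta.
Proof. exact: smooth_measurable smooth_theta. Qed.

Let measurable_e : measurable_fun setT (fun s => e * s).
Proof. by apply: measurable_funM. Qed.

Let measurable_e_gt0 : measurable_fun setT (fun s => 0 < e * s).
Proof. by apply: measurable_fun_ltr. Qed.

Lemma measurable_ker0 : measurable_fun setT ker0.
Proof.
apply: measurable_fun_ifT => //; apply: measurable_funM.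
  exact: (measurableT_comp (measurable_powR _) measurable_e).
exact: (measurableT_comp measurable_theta measurable_e).
Qed.

Lemma theta_le1 t : `|theta t| <= 1.
Proof. by rewrite ger0_norm ?step_ge0// step_le1. Qed.

(** The integrable envelope of [ker0], and up to a constant of the commutator kernel as well. *)
Definition bump_power s := if 0 < e * s <= d then (e * s) `^ (beta - 1) else 0.

Lemma bump_power_ge0 s : 0 <= bump_power s.
Proof. by rewrite /bump_power; case: ifP => // _; exact: powR_ge0. Qed.

Lemma integ_bump_power : integ bump_power.
Proof.
have := integrable_affine 0 e1 (integ_powR_near0 d beta_gt0).
by under eq_fun do rewrite add0r.
Qed.

Lemma ker0_le s : `|ker0 s| <= bump_power s.
Proof.
rewrite /ker0 /bump_power.
have [s0|s0] := ltP 0 (e * s); rewrite /=; last by rewrite normr0.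
have [sd|sd] := leP (e * s) d.
  by rewrite normrM [`|_ `^ _|]ger0_norm ?powR_ge0// ler_piMr ?powR_ge0// theta_le1.
by rewrite theta_eq0 ?mulr0 ?normr0// ltW.
Qed.

Lemma integ_ker0 : integ ker0.
Proof.
exact: (integ_le measurable_ker0 ker0_le integ_bump_power).
Qed.

Lemma ker0_vanishes : vanishes_off (- d) d ker0.
Proof.
move=> s; rewrite -ler_norml -ltNge => ds; rewrite /ker0; case: ifP => // s0.
rewrite theta_eq0 ?mulr0//; move: ds; rewrite -norm_e gtr0_norm//; exact: ltW.
Qed.

(** The derivative is bounded on [[- d, d]], zero to the left of it, and a multiple of
    [t^(beta - 1 - n) = t^(- alpha - 1)] to the right, integrable since [alpha > 0]. This is why [n]
    derivatives must fall on the kernel. *)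
Lemma integ_derive1n_tail : integ (derive1n n tail).
Proof.
have [C hC] := derive1n_powR n (beta - 1).
have sT := smooth_derive1n (k := n) smooth_tail.
have [D D0 hD] := continuous_bounded_on (smooth_continuous sT) d.
pose g t := D * \1_(`[- d, d]%classic) t +
  `|C| * (if d <= t then t `^ (- alpha - 1) else 0).
apply: (@integ_le _ _ g).
- exact: smooth_measurable.
- move=> t; rewrite /g; have g2 : 0 <= `|C| * (if d <= t then t `^ (- alpha - 1) else 0).
    by rewrite mulr_ge0//; case: ifP => // _; exact: powR_ge0.
  have [td|] := leP `|t| d.
    rewrite indicE mem_set/= ?in_itv/= -?ler_norml// mulr1.
    by rewrite (le_trans (hD _ td))// lerDl.
  have [t0|t0] := ltP t 0 => dt.
    rewrite (@eq_on_derive1n R `]-oo, 0[%classic _ (cst 0)).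
    + by rewrite derive1n_cst0 normr0 addr_ge0// mulr_ge0.
    + exact: interval_open.
    + by rewrite /= in_itv.
    + by move=> u; rewrite /= in_itv/= => u0; rewrite /tail ltNge ltW.
  rewrite ger0_norm// in dt.
  rewrite (@eq_on_derive1n R `]d, +oo[%classic _ (fun t => t `^ (beta - 1))).
  + rewrite hC ?(lt_trans d0)// (ltW dt) normrM [`|_ `^ _|]ger0_norm ?powR_ge0//.
    rewrite (_ : beta - 1 - n%:R = - alpha - 1); last by rewrite /beta; ring.
    by rewrite lerDr mulr_ge0.
  + exact: interval_open.
  + by rewrite /= in_itv/= dt.
  + move=> u; rewrite /= in_itv/= andbT => du.
    by rewrite /tail (lt_trans d0 du) theta_eq0 ?subr0 ?mulr1// ltW.
- apply: integD; apply: integZ; first exact: integrable_indic_itv.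
  exact: integ_powR_tail.
Qed.

Lemma integ_kappa : integ kappa.
Proof.
rewrite /kappa /ker1 derive1n_affine; last exact: smooth_tail.
apply: integZ; exact: (integrable_affine 0 e1 integ_derive1n_tail).
Qed.

End Kernels.

(** * The commutator of the singular convolution with a cutoff *)

Section Commutator.
Variable R : realType.
Local Notation mu := (@lebesgue_measure R).
Local Notation integ f := (mu.-integrable setT (EFin \o f)).
Local Notation rT := (measurableTypeR R).
Implicit Types (c s t x y L M : R) (f g h phi chi : R -> R) (j k : nat).
Variables (e d alpha : R).
Hypotheses (e1 : e = 1 \/ e = -1) (d0 : 0 < d) (a0 : 0 < alpha).
Local Notation beta := ((Num.truncn alpha).+1%:R - alpha).
Local Notation ker0 := (ker0 e d alpha).
Local Notation theta := (theta d).
Local Notation bump_power := (bump_power e d alpha).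

Let norm_e x : `|e * x| = `|x|.
Proof. by case: e1 => ->; rewrite ?mul1r// mulN1r normrN. Qed.

Let e_neq0 : e != 0.
Proof. by case: e1 => ->; rewrite ?oner_neq0// oppr_eq0 oner_neq0. Qed.

Let open_e : open [set s | 0 < e * s] /\ open [set s : R | e * s < 0].
Proof.
have E1 : open [set s : R | 0 < s].
  rewrite (_ : [set _ | _] = `]0, +oo[%classic); first exact: interval_open.
  by apply/seteqP; split=> s; rewrite /= in_itv/= andbT.
have E2 : open [set s : R | s < 0].
  rewrite (_ : [set _ | _] = `]-oo, 0[%classic); first exact: interval_open.
  by apply/seteqP; split=> s; rewrite /= in_itv/=.
case: e1 => ->; split.
- by under eq_set do rewrite mul1r.
- by under eq_set do rewrite mul1r.
- by under eq_set do rewrite mulN1r oppr_gt0.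
- by under eq_set do rewrite mulN1r oppr_lt0.
Qed.

Let cut t := t `^ (beta - 1) * theta t.
Let dcut t := (beta - 1) * t `^ (beta - 1 - 1) * theta t +
  t `^ (beta - 1) * derive1 theta t.

Let Dn_cut k : Dn k (`]0, +oo[%classic : set R) cut.
Proof.
apply: (Dn_mul (@open_gt0 R)); first exact: Dn_powR.
apply: (@subset_Dn _ _ _ setT) => //.
by move: k; apply/smoothE; exact: smooth_theta.
Qed.

Let dcutE t : 0 < t -> derive1 cut t = dcut t.
Proof.
move=> t0; have dp : is_derive t (1 : R) (fun u : R => u `^ (beta - 1)) _ := is_derive1_powR _ t0.
case: dp => dp1 dp2.
have := @derive1M _ (fun u : R => u `^ (beta - 1)) theta t dp1
  (@smooth_derivable R _ (@smooth_theta R d) t).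
by move=> ->; congr (_ + _); congr (_ * _); rewrite derive1E dp2.
Qed.

(** The derivative of [ker0] away from 0, written out so that its measurability is apparent, with
    the value 0 at the singular point. *)
Definition dker0 s := if 0 < e * s then e * dcut (e * s) else 0.

Lemma ker0_derivable s : s != 0 -> [/\ derivable ker0 s 1,
  derive1 ker0 s = dker0 s & derivable dker0 s 1].
Proof.
have [op on] := open_e.
rewrite neq_lt => s0; have : (0 < e * s) || (e * s < 0).
  by rewrite -neq_lt eq_sym mulf_neq0// neq_lt.
case/orP=> es.
  have es' : `]0, +oo[%classic (0 + e * s) by rewrite /= in_itv/= add0r es.
  have E x : [set s | 0 < e * s] x -> (fun s => cut (0 + e * s)) x = ker0 x.
    by rewrite /= /ker0 add0r => ->.
  have D1 : derivable cut (0 + e * s) 1 by exact: (@Dn_cut 0 0).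
  have D2 : derivable (derive1 cut) (0 + e * s) 1 by exact: (@Dn_cut 1 1).
  split.
  - exact: (eq_on_derivable op es E (derivable_affine D1)).
  - rewrite -(eq_on_derive1 op es E) derive1_affine//.
    by rewrite /dker0 es add0r dcutE.
  - have E' x : [set s | 0 < e * s] x -> (fun s => e * derive1 cut (0 + e * s)) x = dker0 x.
      by rewrite /= /dker0 add0r => x0; rewrite x0 dcutE.
    apply: (eq_on_derivable op es E').
    by apply: derivableM; [exact: derivable_cst|exact: derivable_affine].
have E x : [set s | e * s < 0] x -> cst 0 x = ker0 x.
  by rewrite /= /ker0 => x0; rewrite ltNge ltW.
have E' x : [set s | e * s < 0] x -> cst 0 x = dker0 x.
  by rewrite /= /dker0 => x0; rewrite ltNge ltW.
split.
- exact: (eq_on_derivable on es E (@derivable_cst _ _ _ _ _ _)).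
- by rewrite -(eq_on_derive1 on es E) derive1_cst /dker0 ltNge ltW.
- exact: (eq_on_derivable on es E' (@derivable_cst _ _ _ _ _ _)).
Qed.

Lemma measurable_dker0 : measurable_fun setT dker0.
Proof.
have me : measurable_fun setT (fun s => e * s) by apply: measurable_funM.
apply: measurable_fun_ifT => //; first by apply: measurable_fun_ltr.
apply: measurable_funM => //; apply: (measurableT_comp _ me).
apply: measurable_funD; apply: measurable_funM.
- by apply: measurable_funM => //; exact: measurable_powR.
- exact: measurable_theta.
- exact: measurable_powR.
- by apply: smooth_measurable; apply: smooth_derive1; exact: smooth_theta.
Qed.

(** One factor [|s|] turns [s^(beta - 2)] into the integrable [s^(beta - 1)]; the term with [theta']
    has [|s| <= d] to spare. *)
Lemma dker0_le : exists2 D : R, 0 <= D &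
  forall s, `|dker0 s| * `|s| <= D * bump_power s.
Proof.
have st' := smooth_derive1 (@smooth_theta R d).
have [C C0 hC] := continuous_bounded_on (smooth_continuous st') d.
exists (`|beta - 1| + C * d).
  by rewrite addr_ge0// mulr_ge0// ltW.
move=> s; rewrite /dker0 /bump_power.
have [es|es] := ltP 0 (e * s); rewrite /=; last by rewrite normr0 mul0r mulr0.
rewrite -(norm_e s); set t := e * s in es *.
have -> : `|e * dcut t| = `|dcut t| by rewrite norm_e.
rewrite [`|t|]gtr0_norm//.
have [td|td] := leP t d; last first.
  have -> : dcut t = 0.
    rewrite /dcut theta_eq0 ?(ltW td)// mulr0 add0r.
    suff -> : derive1 theta t = 0 by rewrite mulr0.
    rewrite (@eq_on_derive1 R `]d, +oo[%classic _ (cst 0)); first by rewrite derive1_cst.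
    - exact: interval_open.
    - by rewrite /= in_itv/= td.
    - by move=> u; rewrite /= in_itv/= andbT => /ltW /(theta_eq0 d0).
  by rewrite normr0 mul0r mulr0.
have tE : t `^ (beta - 1 - 1) * t = t `^ (beta - 1).
  rewrite -{2}[t]powRr1 ?(ltW es)// -powRD ?subrK//.
  by apply/implyP => _; rewrite gt_eqF.
have B : `|dcut t| <= `|beta - 1| * t `^ (beta - 1 - 1) + t `^ (beta - 1) * C.
  apply: (le_trans (ler_normD _ _)); apply: lerD.
    rewrite normrM [`|_ * _ `^ _|]normrM [`|_ `^ _|]ger0_norm ?powR_ge0//.
    by rewrite ler_piMr ?theta_le1// mulr_ge0// powR_ge0.
  rewrite normrM [`|_ `^ _|]ger0_norm ?powR_ge0// ler_wpM2l ?powR_ge0//.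
  by apply: hC; rewrite gtr0_norm.
apply: (le_trans (ler_wpM2r (ltW es) B)).
rewrite mulrDl -mulrA tE mulrDl lerD2l.
rewrite (_ : t `^ (beta - 1) * C * t = C * t * t `^ (beta - 1)); last by ring.
by rewrite ler_wpM2r ?powR_ge0// ler_wpM2l.
Qed.

Lemma smooth_lipschitz f L x y : smooth f -> (forall z, `|derive1 f z| <= L) ->
  `|f x - f y| <= L * `|x - y|.
Proof.
move=> sf fL; wlog xy : x y / y <= x.
  move=> H; have [|xy] := leP y x; first exact: H.
  by rewrite distrC [`|x - y|]distrC; apply: H; exact: ltW.
have df z : z \in `]y, x[%R -> is_derive z (1 : R) f (derive1 f z).
  move=> _; split; first exact: smooth_derivable.
  by rewrite derive1E.
have cf : {within `[y, x], continuous f}.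
  by apply: continuous_subspaceT; exact: smooth_continuous.
have [z _ ->] := MVT_segment xy df cf.
by rewrite normrM ler_wpM2r.
Qed.

Section Identity.
Variables (chi phi : R -> R) (L B M : R) (x : R).
Hypotheses (sc : smooth chi) (sp : smooth phi).
Hypotheses (cL : forall z, `|derive1 chi z| <= L).
Hypotheses (vp : vanishes_off (- M) M phi) (pB : forall z, `|phi z| <= B).

Definition comm_kernel y := dker0 (y - x) * (chi y - chi x).

Let L0 : 0 <= L. Proof. exact: le_trans (cL 0). Qed.
Let B0 : 0 <= B. Proof. exact: le_trans (pB 0). Qed.

Let my : measurable_fun setT (fun y => y - x).
Proof. by apply: measurable_funB. Qed.

Lemma comm_kernel_le (D : R) :
  (forall s, `|dker0 s| * `|s| <= D * bump_power s) ->
  forall y, `|comm_kernel y| <= L * D * bump_power (y - x).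
Proof.
move=> hD y; rewrite /comm_kernel normrM.
apply: (@le_trans _ _ (`|dker0 (y - x)| * (L * `|y - x|))).
  by rewrite ler_wpM2l// smooth_lipschitz.
by rewrite mulrCA -mulrA ler_wpM2l.
Qed.

Let shift_derivable f y : derivable f (y - x) 1 -> derivable (fun y => f (y - x)) y 1 /\
  derive1 (fun y => f (y - x)) y = derive1 f (y - x).
Proof.
have -> : (fun y => f (y - x)) = (fun y => f (- x + 1 * y)).
  by apply/funext => z; rewrite mul1r addrC.
have -> : y - x = - x + 1 * y by rewrite mul1r addrC.
by move=> df; split; [exact: derivable_affine|rewrite derive1_affine// mul1r].
Qed.

(** As a function of [y], [chi x * phi' - (chi phi)'] is the derivative of
    [(chi x - chi y) * phi y]. Integrating by parts puts the derivative on [ker0]; the boundary term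
    at [y = x] vanishes because [chi x - chi y] does. *)
Lemma commutator_by_parts :
  \int[mu]_y (ker0 (y - x) * (chi x * derive1 phi y - derive1 (chi \* phi) y)) =
  \int[mu]_y (comm_kernel y * phi y).
Proof.
have [D D0 hD] := dker0_le.
have sp' := smooth_derive1 sp; have sc' := smooth_derive1 sc.
pose r y := chi x * derive1 phi y - derive1 (chi \* phi) y.
have sr : smooth r.
  have := smooth_add (smooth_scale (c := chi x) sp')
    (smooth_opp (smooth_derive1 (smooth_mul sc sp))).
  by [].
have vr : vanishes_off (- M) M r.
  have v1 : vanishes_off (- M) M (derive1 phi).
    exact: (@vanishes_off_derive1n R _ _ phi 1).
  have v2 : vanishes_off (- M) M (derive1 (chi \* phi)).
    apply: (@vanishes_off_derive1n R _ _ _ 1) => z zM.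
    by rewrite /= vp// mulr0.
  by move=> y yM; rewrite /r v1// v2// mulr0 subr0.
have [Br Br0 rB] := vanishes_off_continuous_bounded (smooth_continuous sr) vr.
have bx : integ (fun y => bump_power (y - x)).
  have := integrable_affine (- x) (or_introl (erefl 1)) (integ_bump_power d alpha e1).
  by under eq_fun do rewrite mul1r addrC.
have kx : integ (fun y => ker0 (y - x)).
  have := integrable_affine (- x) (or_introl (erefl 1)) (integ_ker0 alpha e1 d0).
  by under eq_fun do rewrite mul1r addrC.
have I1 : integ (fun y => ker0 (y - x) * r y).
  by apply: (integ_mulr_bounded kx (smooth_measurable sr) rB).
have mc : measurable_fun setT comm_kernel.
  apply: measurable_funM; first exact: (measurableT_comp measurable_dker0 my).
  by apply: measurable_funB => //; exact: smooth_measurable.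
have I2 : integ (fun y => comm_kernel y * phi y).
  apply: (@integ_mulr_bounded _ _ _ B) => //; last exact: smooth_measurable.
  apply: (@integ_le _ _ (fun y => L * D * bump_power (y - x))) => //.
  - exact: comm_kernel_le.
  - exact: integZ.
apply/eqP; rewrite -subr_eq0 -RintegralB//; apply/eqP.
pose h y := ker0 (y - x) * ((chi x - chi y) * phi y).
have sh : smooth (fun y => (chi x - chi y) * phi y).
  apply: smooth_mul sp.
  by have := smooth_add (@smooth_cst _ (chi x)) (smooth_opp sc).
have dh y : derive1 (fun y => (chi x - chi y) * phi y) y =
    (chi x - chi y) * derive1 phi y - derive1 chi y * phi y.
  have s1 := smooth_add (@smooth_cst _ (chi x)) (smooth_opp sc).
  have := @derive1M _ _ phi y (@smooth_derivable R _ s1 y) (@smooth_derivable R _ sp y).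
  move=> ->; rewrite [X in X * phi y + _](_ : _ = - derive1 chi y).
    by rewrite /=; ring.
  have dchi := @smooth_derivable R _ sc y.
  rewrite derive1E (deriveD (@derivable_cst _ _ _ _ _ _)) ?derive_cst ?add0r; last first.
    exact: derivableN.
  by rewrite deriveN// derive1E.
have E y : ker0 (y - x) * r y - comm_kernel y * phi y =
    dker0 (y - x) * ((chi x - chi y) * phi y) +
    ker0 (y - x) * derive1 (fun y => (chi x - chi y) * phi y) y.
  rewrite dh /r /comm_kernel derive1M; [ring| |]; exact: smooth_derivable.
under eq_Rintegral do rewrite E.
apply: (@Rintegral_derive_eq0 _ h _ x M).
- move=> y0; have [->|yx] := eqVneq y0 x; last first.
    have yx0 : y0 - x != 0 by rewrite subr_eq0.
    have [k1 _ _] := ker0_derivable yx0; have [k4 _] := shift_derivable k1.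
    apply/differentiable_continuous/derivable1_diffP.
    by apply: derivableM; [exact: k4|exact: smooth_derivable].
  have hx : h x = 0 by rewrite /h !subrr mul0r mulr0.
  have beta0 : 0 < beta by rewrite subr_gt0; exact: truncnS_gt.
  apply/(@cvgrPdist_lt _ R) => eps eps0; rewrite hx.
  (* Near [x] one has [|h y| <= L B |y - x|^beta] with [beta > 0]; [eta] solves
     [(L B + 1) eta^beta = eps], where the added 1 keeps the divisor positive. *)
  pose eta := (eps / (L * B + 1)) `^ beta^-1.
  have LB0 : 0 < L * B + 1 by rewrite ltr_wpDl// mulr_ge0.
  have eta0 : 0 < eta by rewrite powR_gt0// divr_gt0.
  exists eta => //= y xy.
  have yx : `|y - x| < eta by rewrite distrC.
  rewrite sub0r normrN /h.
  have [->|yx0] := eqVneq y x; first by rewrite !subrr mul0r mulr0 normr0.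
  have yx1 : 0 < `|y - x| by rewrite normr_gt0 subr_eq0.
  have hb : bump_power (y - x) * `|y - x| <= `|y - x| `^ beta.
    rewrite -(norm_e (y - x)) /bump_power.
    have [es|es] := ltP 0 (e * (y - x)); rewrite /=; last by rewrite mul0r powR_ge0.
    case: ifP => _; last by rewrite mul0r powR_ge0.
    by rewrite gtr0_norm// mulrC mulr_powRB1// ltW.
  have hl : `|ker0 (y - x) * ((chi x - chi y) * phi y)| <= L * B * `|y - x| `^ beta.
    rewrite !normrM.
    apply: (@le_trans _ _ (bump_power (y - x) * ((L * `|y - x|) * B))).
      apply: ler_pM => //; first exact: (ker0_le e alpha d0).
      apply: ler_pM => //; rewrite distrC; exact: smooth_lipschitz.
    rewrite (_ : _ * _ = L * B * (bump_power (y - x) * `|y - x|)); last ring.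
    by rewrite ler_wpM2l// mulr_ge0.
  apply: (le_lt_trans hl).
  apply: (@le_lt_trans _ _ ((L * B + 1) * `|y - x| `^ beta)).
    by rewrite ler_wpM2r ?powR_ge0// lerDl.
  rewrite mulrC -ltr_pdivlMr//.
  have -> : eps / (L * B + 1) = eta `^ beta.
    by rewrite /eta -powRrM mulVf ?gt_eqF// powRr1// ltW// divr_gt0.
  by apply: gt0_ltr_powR => //; rewrite ?nnegrE// ltW.
- by move=> y yM; rewrite /h vp// !mulr0.
- move=> y yx; have yx0 : y - x != 0 by rewrite subr_eq0.
  have [k1 k2 k3] := ker0_derivable yx0.
  have [k4 k5] := shift_derivable k1.
  split; first by apply: derivableM; [exact: k4|exact: smooth_derivable].
  by rewrite (derive1M k4 (@smooth_derivable R _ sh y)) k5 k2.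
- move=> y yx; have yx0 : y - x != 0 by rewrite subr_eq0.
  have [k1 k2 k3] := ker0_derivable yx0.
  have [k4 k5] := shift_derivable k1.
  have [k6 _] := shift_derivable k3.
  apply/differentiable_continuous/derivable1_diffP.
  have k7 := derivableM k6 (@smooth_derivable R _ sh y).
  have k8 := derivableM k4 (@smooth_derivable R _ (smooth_derive1 sh) y).
  exact: (derivableD k7 k8).
- have := integB I1 I2; congr (mu.-integrable setT (EFin \o _)).
  by apply/funext => y; exact: E.
Qed.

End Identity.
End Commutator.

(** * Localizing the fractional derivative *)

Section Fractional_operator.
Variable R : realType.
Local Notation mu := (@lebesgue_measure R).
Local Notation integ f := (mu.-integrable setT (EFin \o f)).
Local Notation rT := (measurableTypeR R).
Implicit Types (c s t x y z L M N : R) (f g h phi chi : R -> R) (i j k m : nat).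
Variables (e d alpha : R).
Hypotheses (e1 : e = 1 \/ e = -1) (d0 : 0 < d) (a0 : 0 < alpha).
Local Notation n := (Num.truncn alpha).+1.
Local Notation ker := (ker e alpha).
Local Notation ker0 := (ker0 e d alpha).
Local Notation ker1 := (ker1 e d alpha).

Definition near_part f := conv 1 ker0 f.
Local Notation J := near_part.

(** The reflection is there because [conv (-1) phi W z] evaluates [W] at [z - y], while [ker1] is
    evaluated at [y - z]. *)
Definition far_kernel := derive1n n (fun s => ker1 (0 + (-1) * s)).
Local Notation W := far_kernel.

(** The fractional derivative up to a constant factor. The [n] derivatives fall on [phi] in the
    singular part and on the kernel in the smooth part. *)
Definition frac_op phi z := J (derive1n n phi) z + conv (-1) phi W z.

Let Ik0 := integ_ker0 alpha e1 d0.
Let vk0 := ker0_vanishes alpha e1 d0.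

Lemma near_part_integ f z : continuous f -> integ (fun y => ker0 y * f (z + 1 * y)).
Proof. exact: conv_integ Ik0 vk0 f z. Qed.

Lemma near_partE f z : measurable_fun setT f ->
  J f z = \int[mu]_y (ker0 (y - z) * f y).
Proof.
move=> mf; rewrite /J /conv.
rewrite -(@Rintegral_affine R (- z) 1 (fun y => ker0 y * f (z + 1 * y))).
- by apply: eq_Rintegral => y _; rewrite !mul1r addrA subrr add0r addrC.
- by left.
- apply: measurable_funM; first exact: measurable_ker0.
  exact: (measurableT_comp mf (measurable_affine z 1)).
Qed.

Lemma smooth_near_part f : smooth f -> smooth (J f).
Proof. by move=> sf; exact: (smooth_conv Ik0 vk0 sf). Qed.

Lemma derive1n_near_part f k : smooth f -> derive1n k (J f) = J (derive1n k f).
Proof. by move=> sf; exact: derive1n_conv Ik0 vk0 _ _ sf. Qed.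

Lemma near_part_vanishes l r f : vanishes_off l r f ->
  vanishes_off (l - d) (r + d) (J f).
Proof.
move=> vf z zlr; rewrite /J /conv (_ : (fun _ => _) = cst 0).
  by rewrite Rintegral_cst// mul0r.
apply/funext => y /=; have [yd|yd] := boolP (- d <= y <= d).
  rewrite vf ?mulr0//; apply: contra zlr => /andP[? ?].
  by case/andP: yd => ? ?; apply/andP; split; lra.
by rewrite vk0// mul0r.
Qed.

Lemma near_part_test_setT phi : test_function setT phi ->
  test_function setT (J phi).
Proof.
move=> /test_functionTP[sp [M vM]]; apply/test_functionTP.
split; first exact: smooth_near_part.
exists (M + d); rewrite opprD; exact: near_part_vanishes.
Qed.

Let smooth_W : smooth W.
Proof.
apply: (@smooth_derive1n R (fun s => ker1 (0 + (-1) * s)) n).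
apply: (@smooth_affine R ker1); exact: smooth_ker1.
Qed.

Lemma integ_far_kernel : integ W.
Proof.
rewrite /W derive1n_affine; last exact: smooth_ker1.
apply: integZ; apply: (@integrable_affine R 0 (-1) (EFin \o kappa e d alpha)).
  by right.
exact: (integ_kappa e1 d0 a0).
Qed.

Definition far_majorant s := `|W (0 + (-1) * s)|.

Lemma integ_far_majorant : integ far_majorant.
Proof.
apply: integ_norm; apply: (@integrable_affine R 0 (-1) (EFin \o W)).
  by right.
exact: integ_far_kernel.
Qed.

Lemma smooth_far_part phi : test_function setT phi -> smooth (conv (-1) phi W).
Proof.
move=> /[dup] tp /test_functionTP[sp [M vM]]; have [C _ pC] := test_setT_bounded tp.
have Ip := bounded_vanishes_off_integ (smooth_measurable sp) vM pC.
exact: (smooth_conv (s := -1) Ip vM smooth_W).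
Qed.

Lemma smooth_frac_op phi : test_function setT phi -> smooth (frac_op phi).
Proof.
move=> tp; apply: smooth_add; last exact: smooth_far_part.
by apply: smooth_near_part; apply: smooth_derive1n; case: tp.
Qed.

Lemma derive1n_ker_integral phi x : test_function setT phi ->
  derive1n n (fun z => \int[mu]_y (phi y * ker (y - z))) x = frac_op phi x.
Proof.
move=> /[dup] tp /test_functionTP[sp [M vM]]; have [C C0 pC] := test_setT_bounded tp.
have Ip := bounded_vanishes_off_integ (smooth_measurable sp) vM pC.
pose B s := ker1 (0 + (-1) * s).
have sB : smooth B by apply: (@smooth_affine R ker1); exact: smooth_ker1.
have BE z y : B (z + (-1) * y) = ker1 (y - z).
  by rewrite /B; congr ker1; ring.
have E : (fun z => \int[mu]_y (phi y * ker (y - z))) = J phi \+ conv (-1) phi B.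
  apply/funext => z; rewrite /= near_partE; last exact: smooth_measurable.
  rewrite /conv -RintegralD//; last 2 first.
  - have mk : integ (fun y => ker0 (y - z)).
      have := integrable_affine (- z) (or_introl (erefl 1)) Ik0.
      by under eq_fun do rewrite mul1r addrC.
    by apply: (integ_mulr_bounded mk _ pC); exact: smooth_measurable.
  - by apply: (conv_integ (-1) Ip vM); exact: smooth_continuous.
  apply: eq_Rintegral => y _; rewrite BE (kerE e d alpha); ring.
rewrite E derive1nD; last 2 first.
- exact: smooth_near_part.
- exact: (smooth_conv (s := -1) Ip vM sB).
rewrite derive1n_near_part// (derive1n_conv (-1) Ip vM _ sB).
by [].
Qed.

Variables (p a b : R).
Hypotheses (p1 : 1 <= p) (ab : a < b).
Local Notation testO := (test_function `]a, b[%classic).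
Local Notation chain := (chain p a b).
Local Notation rep := (rep p).

(** [J] maps test functions of the line to test functions, and its transpose is bounded on [L^p] by
    the [L^1] norm of [ker0]. *)
Lemma rep_near_part (L : (R -> R) -> R) (B : R) : rep L B ->
  rep (fun phi => L (J phi)) (\int[mu]_s `|ker0 s| * B).
Proof.
move=> [h [hp hB hL]].
have mk : measurable_fun [set: rT * rT] (fun z : rT * rT => ker0 (z.2 - z.1)).
  exact: (measurableT_comp (@measurable_ker0 R e d alpha) (@measurable_sub12 R)).
have := rep_kernel p1 hp hB (integ_norm Ik0) (fun s => normr_ge0 _) mk
  (fun x y => lexx _).
apply: rep_ext => phi tp; rewrite hL; last exact: near_part_test_setT.
apply: eq_Rintegral => x _; congr (_ * _); apply: near_partE.
by apply: smooth_measurable; case: tp.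
Qed.

(** Each step shifts one derivative from [J phi] to [v]. The error carries [chi'] and at most as
    many derivatives of [J phi] as [v] can absorb, so [deriv_rep] composed with [J] represents
    it. *)
Lemma reduce_rep j chi : testO chi -> exists2 C : R, 0 <= C &
  forall m v N i, chain m v N -> (i + j <= m)%N ->
  rep (fun phi => \int[mu]_x (chi x * v i x * derive1n j.+1 (J phi) x) -
    (-1) ^+ j * \int[mu]_x (chi x * v (i + j)%N x * derive1 (J phi) x)) (C * N).
Proof.
move=> tc; elim: j => [|j [C C0 hC]].
  (* For [j = 0] the two integrals coincide, and the zero functional is represented with constant
     0. *)
  exists 0 => // m v N i [vp vN _ _]; rewrite addn0 => im.
  have := rep_mul p1 (vp _ im) (vN _ im) (@measurable_cst _ _ _ _ setT (0 : R)) (fun=> lexx `|0|).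
  rewrite normr0; apply: rep_ext => phi _; rewrite mul1r derive1n1 subrr.
  transitivity (\int[mu]_(x in setT) (0 : R)); first by rewrite Rintegral_cst// mul0r.
  by apply: eq_Rintegral => x _; rewrite /= !mul0r.
have [D D0 hD] := deriv_rep p1 ab j.+1 (test_itv_derive1 ab tc).
pose G := \int[mu]_s `|ker0 s|.
have G0 : 0 <= G by exact: Rintegral_ge0.
exists (C + G * D); first by rewrite addr_ge0// mulr_ge0.
move=> m v N i cv im; rewrite mulrDl -mulrA.
have iSjm : (i.+1 + j <= m)%N by rewrite addSnnS.
have i_m : (i < m)%N by rewrite (leq_trans _ iSjm)// leq_addr.
apply: rep_ext (repB p1 (repN p1 (hC _ _ _ _ cv iSjm))
  (rep_near_part (hD _ _ _ _ cv im))).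
move=> phi [sp _]; rewrite derive1nS (chain_mul p1 ab cv i_m tc); last first.
  by apply: smooth_derive1n; exact: smooth_near_part.
rewrite addSnnS exprS mulN1r mulNr opprK opprB addrAC; congr (_ + _).
by rewrite addrC.
Qed.

Lemma commutator_rep chi : testO chi -> exists2 C : R, 0 <= C &
  forall f N, in_Lp p f -> (Lp_norm p setT f <= N%:E)%E ->
  rep (fun phi => \int[mu]_x (chi x * f x * derive1 (J phi) x) -
    \int[mu]_x (f x * derive1 (J (chi \* phi)) x)) (C * N).
Proof.
move=> tc; have sc := test_itv_smooth tc.
have [L L0 cL] := test_setT_bounded (test_setT_derive1 (test_itv_setT ab tc)).
have [Bc Bc0 cB] := test_setT_bounded (test_itv_setT ab tc).
have [D D0 hD] := dker0_le alpha e1 d0.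
(* [L] is a Lipschitz constant of [chi] and [D] comes from the bound on [dker0 s * s]; their product
   with the envelope dominates the commutator kernel. *)
pose k s := L * D * bump_power e d alpha s.
have k0 s : 0 <= k s by rewrite !mulr_ge0// bump_power_ge0.
have Ik : integ k by apply: integZ; exact: (integ_bump_power d alpha e1).
exists (\int[mu]_s k s); first exact: Rintegral_ge0.
move=> f N fp fN.
have mq : measurable_fun [set: rT * rT]
    (fun z : rT * rT => comm_kernel e d alpha chi z.1 z.2).
  apply: measurable_funM.
    exact: (measurableT_comp (@measurable_dker0 R e d alpha) (@measurable_sub12 R)).
  apply: measurable_funB; apply: (measurableT_comp (smooth_measurable sc)) => //.
apply: rep_ext (rep_kernel p1 fp fN Ik k0 mq _); last first.
  by move=> x y; exact: (comm_kernel_le x sc cL hD).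
move=> phi tp; have sp : smooth phi by case: tp.
have scp := smooth_mul sc sp.
have tcp := test_itv_setT ab (test_itv_mul ab tc sp).
have sp' := smooth_derive1 sp; have scp' := smooth_derive1 scp.
have dJ g : smooth g -> derive1 (J g) = J (derive1 g).
  exact: (@derive1n_near_part g 1).
rewrite !dJ// -RintegralB//; last 2 first.
- have := test_itv_integ p1 ab fp tc (smooth_near_part sp').
  by congr (mu.-integrable setT (EFin \o _)); apply/funext => x; ring.
- have := in_Lp_test_integ p1 fp (near_part_test_setT (test_setT_derive1 tcp)).
  by [].
apply: eq_Rintegral => x _.
set j1 := J (derive1 phi) x; set j2 := J (derive1 (chi \* phi)) x.
transitivity (f x * (chi x * j1 - j2)); first by ring.
rewrite /j1 /j2; congr (_ * _).
have [B _ pB] := test_setT_bounded tp.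
have [_ [M vM]] := (test_functionTP phi).1 tp.
rewrite -(commutator_by_parts alpha e1 d0 x sc sp cL vM pB).
pose r y := chi x * derive1 phi y - derive1 (chi \* phi) y.
have mr : measurable_fun setT r.
  by apply: measurable_funB; [apply: measurable_funM => //|]; exact: smooth_measurable.
have <- : J r x = \int[mu]_y (ker0 (y - x) * r y) by exact: near_partE.
rewrite /J /conv -RintegralZl//; last by apply: near_part_integ; exact: smooth_continuous.
rewrite -RintegralB//.
- by apply: eq_Rintegral => y _; rewrite /r; ring.
- by apply: integZ; apply: near_part_integ; exact: smooth_continuous.
- by apply: near_part_integ; exact: smooth_continuous.
Qed.

(** Used with the weights [(chi, 1)] and [(1, chi)], that is, with the cutoff applied after or
    before the smooth part. *)
Lemma far_part_rep (A1 A2 : R -> R) (B1 B2 : R) : measurable_fun setT A1 ->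
  measurable_fun setT A2 -> (forall x, `|A1 x| <= B1) -> (forall x, `|A2 x| <= B2) ->
  exists2 C : R, 0 <= C & forall f N, in_Lp p f -> (Lp_norm p setT f <= N%:E)%E ->
  rep (fun phi => \int[mu]_x (f x * (A1 x * conv (-1) (A2 \* phi) W x))) (C * N).
Proof.
move=> m1 m2 A1B A2B; have B10 : 0 <= B1 by exact: le_trans (A1B 0).
have B20 : 0 <= B2 by exact: le_trans (A2B 0).
pose k s := B1 * B2 * far_majorant s.
have k0 s : 0 <= k s by apply: mulr_ge0; [exact: mulr_ge0|exact: normr_ge0].
have Ik : integ k by apply: integZ; exact: integ_far_majorant.
exists (\int[mu]_s k s); first exact: Rintegral_ge0.
move=> f N fp fN.
pose q x y := A1 x * (A2 y * W (x + (-1) * y)).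
have mq : measurable_fun [set: rT * rT] (fun z : rT * rT => q z.1 z.2).
  apply: measurable_funM; first exact: (measurableT_comp m1 measurable_fst).
  apply: measurable_funM; first exact: (measurableT_comp m2 measurable_snd).
  apply: (measurableT_comp (smooth_measurable smooth_W)).
  by apply: measurable_funD => //; apply: measurable_funM.
apply: rep_ext (rep_kernel p1 fp fN Ik k0 mq _); last first.
  move=> x y; rewrite /q /k /far_majorant normrM -mulrA ler_pM//.
  rewrite normrM (_ : x + -1 * y = 0 + -1 * (y - x)); last by ring.
  by rewrite ler_wpM2r.
move=> phi tp; apply: eq_Rintegral => x _; congr (_ * _).
have [C _ pC] := test_setT_bounded tp; have sp : smooth phi by case: tp.
have [_ [M vM]] := (test_functionTP phi).1 tp.
have mA : measurable_fun setT (A2 \* phi).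
  by apply: measurable_funM => //; exact: smooth_measurable.
have vA : vanishes_off (- M) M (A2 \* phi).
  by move=> y yM; rewrite /= vM// mulr0.
have cA y : `|(A2 \* phi) y| <= B2 * C by rewrite /= normrM ler_pM.
have IA := bounded_vanishes_off_integ mA vA cA.
rewrite /conv -RintegralZl//.
  by apply: eq_Rintegral => y _; rewrite /q /=; ring.
by apply: (conv_integ (-1) IA vA); exact: smooth_continuous.
Qed.

(** The functional is a sum of five represented ones: the reduction to order one, the commutator,
    the two smooth parts, and [w] tested against [chi phi]. The margin [d] between [[l, r]] and the
    ends of the interval leaves room for the spreading by [J]. *)
Lemma frac_rep chi l r c : testO chi -> vanishes_off l r chi ->
  a < l - d -> r + d < b -> exists2 C : R, 0 <= C &
  forall v w N, chain (Num.truncn alpha) v N ->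
  in_Lp p w -> (Lp_norm p setT w <= N%:E)%E ->
  (forall phi, testO phi ->
    \int[mu]_x (w x * phi x) = c * \int[mu]_x (v 0%N x * frac_op phi x)) ->
  rep (fun phi => c * \int[mu]_x (chi x * v 0%N x * frac_op phi x)) (C * N).
Proof.
move=> tc vc al rb; have sc := test_itv_smooth tc; have mc := smooth_measurable sc.
have [B B0 cB] := test_setT_bounded (test_itv_setT ab tc).
have m1 : measurable_fun setT (cst 1 : R -> R) by apply: smooth_measurable; exact: smooth_cst.
have b1 (x : R) : `|cst (1 : R) x| <= 1 by rewrite normr1.
pose m := Num.truncn alpha.
have [C1 C10 h1] := reduce_rep m tc.
have [C2 C20 h2] := commutator_rep tc.
have [C3 C30 h3] := far_part_rep mc m1 cB b1.
have [C4 C40 h4] := far_part_rep m1 mc b1 cB.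
exists (`|c| * C1 + `|c * (-1) ^+ m| * C2 + `|c| * C3 + `|c| * C4 + B).
  by rewrite !addr_ge0// mulr_ge0.
move=> v w N cv wp wN wE; have [vp vN vab _] := cv.
have r1 := repZ p1 c (h1 m v N 0%N cv (leqnn _)).
have r2 := repZ p1 (c * (-1) ^+ m) (h2 _ _ (vp _ (leqnn m)) (vN _ (leqnn m))).
have r3 := repZ p1 c (h3 _ _ (vp _ (leq0n m)) (vN _ (leq0n m))).
have r4 := repZ p1 c (h4 _ _ (vp _ (leq0n m)) (vN _ (leq0n m))).
have r5 := rep_mul p1 wp wN mc cB.
rewrite !mulrDl -!mulrA.
apply: rep_ext (repD p1 (repB p1 (repD p1 (repD p1 r1 r2) r3) r4) r5) => phi tp.
have sp : smooth phi by case: tp.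
have tcp := test_itv_mul ab tc sp.
have tcpT := test_itv_setT ab tcp.
have tJ : testO (J (chi \* phi)).
  have vcp : vanishes_off l r (chi \* phi) by move=> x xlr; rewrite /= vc// mul0r.
  apply/(test_function_itvP _ ab); split; first exact: smooth_near_part (smooth_mul sc sp).
  have := near_part_vanishes vcp => vJ.
  (* If [l - d > r + d], then [J (chi phi)] is identically 0 and a one-point segment serves as its
     support. *)
  have [lr|rl] := leP (l - d) (r + d); first by exists (l - d), (r + d).
  have [am mb] := midf_lt ab.
  exists ((a + b) / 2), ((a + b) / 2); split=> // x _; apply: vJ.
  by apply/negP => /andP[lx xr]; have := le_lt_trans (le_trans lx xr) rl; rewrite ltxx.
rewrite add0n.
(* Here the derivatives go back to [v 0], which is legitimate because [J (chi phi)] is a test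
   function on the interval; the two signs [(-1)^m] cancel. *)
have E1 : (-1) ^+ m * \int[mu]_x (v m x * derive1 (J (chi \* phi)) x) =
    \int[mu]_x (v 0%N x * frac_op (chi \* phi) x) -
    \int[mu]_x (v 0%N x * (cst 1 x * conv (-1) (chi \* phi) W x)).
  have := chain_iter ab (i := 0) (k := m) cv (leqnn m) (test_itv_derive1 ab tJ).
  rewrite add0n => ->; rewrite mulrA -exprD -signr_odd oddD addbb expr0 mul1r.
  rewrite -RintegralB//; last 2 first.
  - apply: (integ_vanishing p1 (vp _ (leq0n m)) (vab _ (leq0n m))).
    exact: smooth_continuous (smooth_frac_op tcpT).
  - apply: (integ_vanishing p1 (vp _ (leq0n m)) (vab _ (leq0n m))).
    apply: smooth_continuous; apply: smooth_mul; first exact: smooth_cst.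
    exact: smooth_far_part.
  apply: eq_Rintegral => x _; rewrite -derive1nSr derive1n_near_part; last exact: smooth_mul.
  by rewrite /frac_op /=; ring.
have E2 : \int[mu]_x (chi x * v 0%N x * frac_op phi x) =
    \int[mu]_x (chi x * v 0%N x * derive1n m.+1 (J phi) x) +
    \int[mu]_x (v 0%N x * (chi x * conv (-1) (cst 1 \* phi) W x)).
  have c1 : cst 1 \* phi = phi by apply/funext => x; rewrite /= mul1r.
  rewrite c1 -RintegralD//.
  - apply: eq_Rintegral => x _; rewrite derive1n_near_part//.
    by rewrite /frac_op; ring.
  - have := test_itv_integ p1 ab (vp _ (leq0n m)) tc
      (smooth_derive1n (k := m.+1) (smooth_near_part sp)).
    by congr (mu.-integrable setT (EFin \o _)); apply/funext => x; ring.
  - exact: (test_itv_integ p1 ab (vp _ (leq0n m)) tc (smooth_far_part tp)).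
have E3 := wE _ tcp.
have E4 : \int[mu]_x (w x * (chi \* phi) x) = \int[mu]_x (chi x * w x * phi x).
  by apply: eq_Rintegral => x _ /=; ring.
(* Telescoping identity: [Bm] and [D] are the two halves of the commutator, [F] and [H] the smooth
   parts, [X] the term known from the weak fractional derivative. *)
have key (A Bm D F H X sg : R) : sg * D = X - H ->
    c * (A + F) = c * (A - sg * Bm) + c * sg * (Bm - D) + c * F - c * H + c * X.
  by move=> h; have -> : X = sg * D + H; [rewrite h subrK|ring].
rewrite E2 -E4 E3; exact: key E1.
Qed.

End Fractional_operator.

(** * The extension operator *)

Section Extension.
Variable R : realType.
Local Notation mu := (@lebesgue_measure R).
Local Notation integ f := (mu.-integrable setT (EFin \o f)).
Implicit Types (x y z N : R) (f g h phi chi u w : R -> R) (i j k : nat).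

(** The Gamma factor and the sign go into [c]. The scale [d] of the kernel splitting is arbitrary,
    so it can be adapted to the cutoff. *)
Lemma frac_derivativeE sd (alpha d : R) : 0 < alpha -> 0 < d ->
  exists c e : R, (e = 1 \/ e = -1) /\
  forall phi x, test_function setT phi ->
    frac_derivative sd alpha phi x = c * frac_op e d alpha phi x.
Proof.
move=> a0 d0; set n := (Num.truncn alpha).+1.
have powE s : (s `^ (alpha - n%:R + 1))^-1 = s `^ (n%:R - alpha - 1).
  by rewrite -powRN; congr powR; ring.
case: sd; rewrite /frac_derivative -/n.
  exists (Gamma (n%:R - alpha))^-1, (-1); split; first by right.
  move=> phi x tp; congr (_ * _).
  rewrite -(@derive1n_ker_integral R (-1) d alpha (or_intror erefl) d0 phi x tp).
  congr (derive1n n _ x); apply/funext => z.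
  rewrite Rintegral_mkcond; apply: eq_Rintegral => y _; rewrite patchE /ker mulN1r opprB.
  case: ifPn; first by rewrite inE /= in_itv/= -subr_gt0 => ->; rewrite powE.
  by rewrite notin_setE /= in_itv/= -subr_gt0 => /negP/negbTE ->; rewrite mulr0.
exists ((-1) ^+ n / Gamma (n%:R - alpha)), 1; split; first by left.
move=> phi x tp; congr (_ * _).
rewrite -(@derive1n_ker_integral R 1 d alpha (or_introl erefl) d0 phi x tp).
congr (derive1n n _ x); apply/funext => z.
rewrite Rintegral_mkcond; apply: eq_Rintegral => y _; rewrite patchE /ker mul1r.
case: ifPn; first by rewrite inE /= in_itv/= andbT -subr_gt0 => ->; rewrite powE.
by rewrite notin_setE /= in_itv/= andbT -subr_gt0 => /negP/negbTE ->; rewrite mulr0.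
Qed.

Variables (s : side) (alpha p a b d : R).
Hypotheses (a0 : 0 < alpha) (p1 : 1 <= p) (d0 : 0 < d) (abd : a + 3 * d <= b - 3 * d).
Local Notation Omega := (`]a, b[%classic).
Local Notation m := (Num.truncn alpha).

Let p0 : 0 < p. Proof. exact: lt_le_trans p1. Qed.
Let ab : a < b. Proof. by have := abd; have := d0; lra. Qed.

(** The margin [2 d] exceeds the spreading [d] of [J]; after a ramp of width [d] the cutoff equals 1
    on [[a + 3 d, b - 3 d]]. *)
Definition chi0 := cutoff (a + 2 * d) (b - 2 * d) d.
Local Notation chi := chi0.

Definition extension u := chi \* u.

Lemma chi_smooth : smooth chi.
Proof. exact: smooth_cutoff. Qed.

Lemma chi_vanishes : vanishes_off (a + 2 * d) (b - 2 * d) chi.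
Proof. exact: cutoff_vanishes. Qed.

Lemma chi_test : test_function Omega chi.
Proof.
apply/(test_function_itvP _ ab); split; first exact: chi_smooth.
exists (a + 2 * d), (b - 2 * d).
by split; [have := d0; lra|have := abd; have := d0; lra|have := d0; lra|exact: chi_vanishes].
Qed.

(** Values of [u] outside [Omega] are irrelevant to the extension, so it respects classes modulo
    almost everywhere equality on [Omega]. *)
Lemma extension_patch u : extension u = chi \* (u \_ Omega).
Proof.
apply/funext => x; rewrite /extension /= patchE; case: ifPn => //.
rewrite notin_setE /= in_itv/= => /negP xO; rewrite chi_vanishes ?mul0r//.
apply: contra xO => /andP[h1 h2]; have := d0.
by move=> ?; apply/andP; split; lra.
Qed.

Lemma Rintegral_patch v f :
  \int[mu]_(x in Omega) (v x * f x) = \int[mu]_x ((v \_ Omega) x * f x).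
Proof.
rewrite Rintegral_mkcond; apply: eq_Rintegral => x _; rewrite !patchE.
by case: ifP => // _; rewrite mul0r.
Qed.

Lemma Lp_norm_patch v : Lp_norm p setT (v \_ Omega) = Lp_norm p Omega v.
Proof. by rewrite /Lp_norm patch_setT. Qed.

Lemma Lp_patch v : Lp p Omega v <-> in_Lp p (v \_ Omega).
Proof.
split=> [h|/(in_LpP _ p1)]; last by rewrite /Lp patch_setT.
by apply/(in_LpP _ p1); rewrite /Lp patch_setT.
Qed.

Definition derivative_family u (V : nat -> R -> R) :=
  V 0%N = u /\ forall k, (1 <= k <= m)%N -> is_weak_derivative k Omega u (V k).

(** Each [V k] is known only as the [k]-th weak derivative of [u]. Testing [V k] with [phi'] and
    [V k.+1] with [phi] reduces both to [u], which links consecutive terms. *)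
Lemma derivative_family_chain u V N : derivative_family u V ->
  (forall k, (k <= m)%N -> Lp p Omega (V k)) ->
  (forall k, (k <= m)%N -> (Lp_norm p Omega (V k) <= N%:E)%E) ->
  chain p a b m (fun k => V k \_ Omega) N.
Proof.
move=> [V0 VE] VL VN; split.
- by move=> i im; apply/Lp_patch; exact: VL.
- by move=> i im; rewrite Lp_norm_patch; exact: VN.
- move=> i im x xab; rewrite patchE memNset//= in_itv/=; apply/negP.
  by apply: contra xab => /andP[/ltW -> /ltW ->].
have E k phi : (k <= m)%N -> test_function Omega phi ->
    \int[mu]_x ((V k \_ Omega) x * phi x) =
    (-1) ^+ k * \int[mu]_(x in Omega) (u x * derive1n k phi x).
  case: k => [_ _|k km tp]; first by rewrite V0 mul1r -Rintegral_patch.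
  by rewrite -Rintegral_patch; have [_ ->] := VE k.+1 km.
move=> i phi im tp; rewrite E// E//; [|exact: ltnW|exact: test_itv_derive1].
by rewrite exprS mulN1r mulNr derive1nSr.
Qed.

Lemma rep_weak_derivative k u C : rep p (fun phi =>
    (-1) ^+ k * \int[mu]_x (extension u x * derive1n k phi x)) C ->
  exists h, [/\ is_weak_derivative k setT (extension u) h, in_Lp p h &
    (Lp_norm p setT h <= C%:E)%E].
Proof.
move=> [h [hp hC hE]]; exists h; split=> //; split.
  exact: (in_Lp_locally_integrable p1).
by move=> phi /hE <-.
Qed.

(** The weak derivatives [V] and [w] of [u] are left arbitrary: any ones in [L^p] serve for
    membership, and the chosen ones of the norm serve for the estimate. *)
Lemma weak_derivative_bounds : exists2 D : R, 0 <= D &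
  forall u V w N, derivative_family u V ->
  (forall k, (k <= m)%N -> Lp p Omega (V k)) ->
  (forall k, (k <= m)%N -> (Lp_norm p Omega (V k) <= N%:E)%E) ->
  is_weak_frac_derivative s alpha Omega u w ->
  Lp p Omega w -> (Lp_norm p Omega w <= N%:E)%E ->
  [/\ in_Lp p (extension u) /\ (Lp_norm p setT (extension u) <= (D * N)%:E)%E,
   forall k, (1 <= k <= m)%N -> exists h,
     [/\ is_weak_derivative k setT (extension u) h, in_Lp p h &
       (Lp_norm p setT h <= (D * N)%:E)%E] &
   exists h, [/\ is_weak_frac_derivative s alpha setT (extension u) h, in_Lp p h &
       (Lp_norm p setT h <= (D * N)%:E)%E]].
Proof.
have [c0 [e [e1 fE]]] := frac_derivativeE (opposite s) a0 d0.
pose c := (-1) ^+ m * c0.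
have al : a < a + 2 * d - d by have := d0; lra.
have br : b - 2 * d + d < b by have := d0; lra.
have [F F0 hF] := frac_rep e1 d0 a0 p1 ab c chi_test chi_vanishes al br.
have /choice [Ck hCk] : forall k, exists C : R, 0 <= C /\ forall m v N i,
    chain p a b m v N -> (i + k <= m)%N ->
    rep p (fun phi => \int[mu]_x (chi x * v i x * derive1n k phi x)) (C * N).
  by move=> k; have [C C0 hC] := deriv_rep p1 ab k chi_test; exists C.
(* One constant for all bounds: 1 for [chi u], [F] for the fractional derivative, [Ck k] for the
   derivative of order [k]. *)
exists (1 + F + \sum_(k < m.+1) Ck k).
  by rewrite !addr_ge0// sumr_ge0// => i _; have [] := hCk i.
move=> u V w N dV VL VN [lw wE] wL wN.
have cv := derivative_family_chain dV VL VN.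
have N0 := chain_ge0 cv.
have CkD (k : nat) : (k <= m)%N -> Ck k <= 1 + F + \sum_(k < m.+1) Ck k.
  move=> km; rewrite (bigD1 (Ordinal (km : (k < m.+1)%N)))//= addrCA lerDl.
  by rewrite !addr_ge0// sumr_ge0// => i _; have [] := hCk i.
have S0 : 0 <= \sum_(k < m.+1) Ck k by rewrite sumr_ge0// => i _; have [] := hCk i.
have V0 : V 0%N = u by case: dV.
have Eu x : extension u x = chi x * (V 0%N \_ Omega) x.
  by rewrite extension_patch V0.
have u0 : in_Lp p (V 0%N \_ Omega) by apply/Lp_patch; exact: VL.
have mchi := smooth_measurable chi_smooth.
split.
- have [] := @in_Lp_mul _ _ p1 (V 0%N \_ Omega) chi N 1 u0 _ mchi _.
  + by rewrite Lp_norm_patch; exact: VN.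
  + by move=> x; rewrite ger0_norm ?cutoff_ge0// cutoff_le1.
  rewrite V0 -extension_patch => h1 h2; split=> //; apply: (le_trans h2).
  by rewrite lee_fin ler_wpM2r// -addrA lerDl addr_ge0.
- move=> k /andP[k1 km]; have [Ck0 hk] := hCk k.
  apply: rep_weak_derivative.
  have r := repZ p1 ((-1) ^+ k) (hk m _ _ 0%N cv km).
  rewrite normrX normrN normr1 expr1n mul1r in r.
  have r' := rep_le (ler_wpM2r N0 (CkD _ km)) r.
  apply: rep_ext r' => phi _; congr (_ * _).
  by apply: eq_Rintegral => x _; rewrite Eu.
- have wE' phi : test_function Omega phi -> \int[mu]_x ((w \_ Omega) x * phi x) =
      c * \int[mu]_x ((V 0%N \_ Omega) x * frac_op e d alpha phi x).
    move=> tp; have tpT := test_itv_setT ab tp.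
    rewrite -Rintegral_patch wE// -mulrA; congr (_ * _).
    rewrite Rintegral_patch V0 -RintegralZl//; last first.
      rewrite -V0; apply: (integ_vanishing (a := a) (b := b) p1 u0).
        by move=> x xab; rewrite patchE memNset//= in_itv/=; apply/negP;
          apply: contra xab => /andP[/ltW -> /ltW ->].
      exact: smooth_continuous (smooth_frac_op e1 d0 tpT).
    by apply: eq_Rintegral => x _; rewrite fE//; ring.
  have wL' := (Lp_patch w).1 wL.
  have wN' : (Lp_norm p setT (w \_ Omega) <= N%:E)%E by rewrite Lp_norm_patch.
  have [h [hp hN hE]] := hF _ _ _ cv wL' wN' wE'.
  exists h; split=> //.
    split; first exact: (in_Lp_locally_integrable p1).
    move=> phi tp; rewrite -hE// -mulrA; congr (_ * _).
    have I : integ (fun x => chi x * (V 0%N \_ Omega) x * frac_op e d alpha phi x).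
      have := test_itv_integ p1 ab u0 chi_test (smooth_frac_op e1 d0 tp (alpha := alpha)).
      by congr (mu.-integrable setT (EFin \o _)); apply/funext => x; ring.
    rewrite -RintegralZl//.
    by apply: eq_Rintegral => x _; rewrite fE// Eu; ring.
  apply: (le_trans hN); rewrite lee_fin ler_wpM2r//.
  by rewrite [1 + F]addrC -addrA lerDl addr_ge0.
Qed.

Lemma Lp_norm_fin v : Lp p Omega v -> Lp_norm p Omega v = (fine (Lp_norm p Omega v))%:E.
Proof.
move=> /Lp_patch[_ h]; rewrite fineK// -Lp_norm_patch Lp_norm_setT ge0_fin_numE ?poweR_ge0//.
exact: poweR_lty.
Qed.

Lemma extension_class_mapping :
  class_mapping Omega setT (frac_sobolev s alpha p Omega)
    (frac_sobolev s alpha p setT) extension.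
Proof.
split; last first.
  move=> u v _ _; apply: ae_imp => x uv _; rewrite !extension_patch /= !patchE.
  by case: ifPn => // xO; rewrite uv// -inE.
move=> u [[uL uW] [w wF wL]].
have /choice [V VP] : forall k, exists v, (k = 0%N -> v = u) /\
    ((1 <= k <= m)%N -> is_weak_derivative k Omega u v /\ Lp p Omega v).
  case=> [|k]; first by exists u; split.
  have [/uW[v v1 v2]|nk] := boolP (1 <= k.+1 <= m)%N; first by exists v.
  by exists u; split.
have V0 : V 0%N = u by have [->] := VP 0%N.
have dV : derivative_family u V.
  by split=> // k km; have [_ /(_ km)[]] := VP k.
have VL k : (k <= m)%N -> Lp p Omega (V k).
  by case: k => [_|k km]; [rewrite V0|have [_ /(_ km)[]] := VP k.+1].
pose nV k := fine (Lp_norm p Omega (V k)).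
have nV0 k : 0 <= nV k by rewrite fine_ge0// /Lp_norm Lnorm_ge0.
pose nw := fine (Lp_norm p Omega w).
have nw0 : 0 <= nw by rewrite fine_ge0// /Lp_norm Lnorm_ge0.
pose N := \sum_(k < m.+1) nV k + nw.
have VN k : (k <= m)%N -> (Lp_norm p Omega (V k) <= N%:E)%E.
  move=> km; rewrite (Lp_norm_fin (VL _ km)) lee_fin /N.
  rewrite (bigD1 (Ordinal (km : (k < m.+1)%N)))//= -addrA lerDl.
  by rewrite addr_ge0// sumr_ge0.
have wN : (Lp_norm p Omega w <= N%:E)%E.
  by rewrite (Lp_norm_fin wL) lee_fin /N lerDr sumr_ge0.
have [D _ hD] := weak_derivative_bounds.
have [[h1 _] h2 [h [h3 h4 _]]] := hD _ _ _ _ dV VL VN wF wL wN.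
split; last by exists h => //; apply/(in_LpP _ p1).
split; first exact/(in_LpP _ p1).
by move=> k /h2[g [g1 g2 _]]; exists g => //; apply/(in_LpP _ p1).
Qed.

Lemma le_root_sum (x y : \bar R) : (0 <= x)%E -> (0 <= y)%E ->
  (x <= (x `^ p + y) `^ p^-1)%E.
Proof.
move=> x0 y0.
have {1}-> : x = ((x `^ p) `^ p^-1)%E by rewrite -poweRrM mulfV ?gt_eqF// poweRe1.
apply: gt0_ler_poweR; first by rewrite invr_ge0 ltW.
- by rewrite in_itv/= leey poweR_ge0.
- by rewrite in_itv/= leey andbT adde_ge0// poweR_ge0.
- by rewrite leeDl.
Qed.

(** A chosen weak derivative need not be the one that membership provides in [L^p]; finiteness of
    the norm gives its integrability without a uniqueness argument on [Omega]. *)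
Lemma Lp_of_fin_norm v N : measurable_fun Omega v ->
  (Lp_norm p Omega v <= N%:E)%E -> Lp p Omega v.
Proof.
move=> mv vN; apply/Lp_patch; split.
  by apply/(measurable_restrictT _ _).1 => //; exact: measurable_itv.
have : (Lp_norm p setT (v \_ Omega) < +oo)%E.
  by rewrite Lp_norm_patch (le_lt_trans vN)// ltry.
rewrite Lp_norm_setT => /lty_poweRy; apply.
by rewrite invr_eq0 gt_eqF.
Qed.

Lemma extension_norm_bound : exists2 C : R, 0 < C &
  forall u, frac_sobolev s alpha p Omega u ->
  (frac_sobolev_norm s alpha p setT (extension u) <=
   C%:E * frac_sobolev_norm s alpha p Omega u)%E.
Proof.
have [D D0 hD] := weak_derivative_bounds.
(* The norm has [m + 2] terms: the function, [m] derivatives and the fractional one, each at most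
   [D N]. The added 1 ensures positivity. *)
exists ((m.+2%:R) `^ p^-1 * D + 1).
  by rewrite ltr_wpDl// mulr_ge0// powR_ge0.
set C := _ + 1; have C0 : 0 < C by rewrite ltr_wpDl// mulr_ge0// powR_ge0.
move=> u [[uL uW] [w0 wF0 wL0]].
set NN := frac_sobolev_norm _ _ _ _ u.
have NN0 : (0 <= NN)%E by exact: poweR_ge0.
(* An infinite norm of [u] makes the bound trivial; a finite value [N] bounds each term of the
   norm. *)
move: NN0; case NE : NN => [N| |] N0; last by rewrite leNgt ltNyr in N0.
  2: by rewrite gt0_muley ?lte_fin// leey.
rewrite lee_fin in N0.
pose V k := if k is 0 then u else weak_derivative k Omega u.
pose w := weak_frac_derivative s alpha Omega u.
have wF : is_weak_frac_derivative s alpha Omega u w.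
  by apply: (@xgetPex _ (cst 0) [set v | is_weak_frac_derivative s alpha Omega u v]); exists w0.
have dV : derivative_family u V.
  split=> // -[//|k] km; have [v v1 _] := uW _ km.
  by apply: (@xgetPex _ (cst 0) [set v | is_weak_derivative k.+1 Omega u v]); exists v.
have Lge0 v : (0 <= Lp_norm p Omega v)%E by exact: Lnorm_ge0.
have Sge0 : (0 <= \sum_(1 <= k < m.+1) Lp_norm p Omega (weak_derivative k Omega u) `^ p)%E.
  by apply: sume_ge0 => k _; exact: poweR_ge0.
have sN : (sobolev_norm m p Omega u <= N%:E)%E.
  by rewrite -NE; apply: le_root_sum => //; exact: poweR_ge0.
have wN : (Lp_norm p Omega w <= N%:E)%E.
  by rewrite -NE /NN /frac_sobolev_norm addeC; apply: le_root_sum => //; exact: poweR_ge0.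
have VN k : (k <= m)%N -> (Lp_norm p Omega (V k) <= N%:E)%E.
  move=> km; apply: le_trans sN; rewrite /sobolev_norm.
  case: k km => [_|k km]; first exact: le_root_sum.
  rewrite (bigD1_seq k.+1) ?iota_uniq ?mem_index_iota//= addeCA.
  by apply: le_root_sum => //; rewrite adde_ge0 ?poweR_ge0// sume_ge0// => *; exact: poweR_ge0.
have wL : Lp p Omega w by apply: Lp_of_fin_norm wN; case: wF => -[].
have VL k : (k <= m)%N -> Lp p Omega (V k).
  case: k => [_ //|k km]; apply: Lp_of_fin_norm (VN _ km).
  by have [_ /(_ k.+1 km)[[]]] := dV.
have [[h1 h1N] h2 [h [h3 h4 hN]]] := hD _ _ _ _ dV VL VN wF wL wN.
(* The chosen weak derivatives on the line agree almost everywhere with the constructed ones and so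
   have the same norm. *)
have uniq_norm g1 g2 : locally_integrable setT g1 -> locally_integrable setT g2 ->
    (forall phi, test_function setT phi ->
      \int[mu]_x (g1 x * phi x) = \int[mu]_x (g2 x * phi x)) ->
    Lp_norm p setT g1 = Lp_norm p setT g2.
  move=> l1 l2 g12; apply: ae_eq_Lp_norm; [by case: l1|by case: l2|].
  exact: weak_unique.
have B0 : (0 <= (D * N)%:E)%E by rewrite lee_fin mulr_ge0.
have powB (x : \bar R) : (0 <= x)%E -> (x <= (D * N)%:E)%E -> (x `^ p <= ((D * N) `^ p)%:E)%E.
  move=> x0 xB; rewrite -poweR_EFin; apply: gt0_ler_poweR; first exact: ltW.
  - by rewrite in_itv/= leey x0.
  - by rewrite in_itv/= leey B0.
  - exact: xB.
have Eu : (Lp_norm p setT (extension u) `^ p <= ((D * N) `^ p)%:E)%E.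
  by apply: powB => //; exact: Lnorm_ge0.
have Ek k : (1 <= k <= m)%N ->
    (Lp_norm p setT (weak_derivative k setT (extension u)) `^ p <= ((D * N) `^ p)%:E)%E.
  move=> km; apply: powB; first exact: Lnorm_ge0.
  have [g [[g1 g1E] g2 gN]] := h2 _ km.
  have [x1 x1E] : is_weak_derivative k setT (extension u)
      (weak_derivative k setT (extension u)).
    by apply: (@xgetPex _ (cst 0) [set v | is_weak_derivative k setT (extension u) v]); exists g.
  by rewrite (@uniq_norm _ g)// => phi tp; rewrite x1E// g1E.
have Ew : (Lp_norm p setT (weak_frac_derivative s alpha setT (extension u)) `^ p
    <= ((D * N) `^ p)%:E)%E.
  apply: powB; first exact: Lnorm_ge0.
  have [g1 g1E] := h3.
  have [x1 x1E] : is_weak_frac_derivative s alpha setT (extension u)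
      (weak_frac_derivative s alpha setT (extension u)).
    by apply: (@xgetPex _ (cst 0)
      [set v | is_weak_frac_derivative s alpha setT (extension u) v]); exists h.
  by rewrite (@uniq_norm _ h)// => phi tp; rewrite x1E// g1E.
rewrite /frac_sobolev_norm /sobolev_norm -poweRrM mulVf ?gt_eqF// poweRe1; last first.
  by rewrite adde_ge0 ?poweR_ge0// sume_ge0// => *; exact: poweR_ge0.
set S := (_ + _)%E.
have SB : (S <= (m.+2%:R * (D * N) `^ p)%:E)%E.
  have -> : m.+2%:R * (D * N) `^ p = (D * N) `^ p + m%:R * (D * N) `^ p + (D * N) `^ p.
    by rewrite -addn2 natrD; ring.
  rewrite /S !EFinD leeD// leeD//.
  apply: (@le_trans _ _ (\sum_(1 <= k < m.+1) ((D * N) `^ p)%:E)%E).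
    rewrite big_nat_cond [leRHS]big_nat_cond; apply: lee_sum => k.
    by rewrite andbT ltnS => km; exact: Ek.
  by rewrite sumEFin lee_fin sumr_const_nat subSS subn0 mulr_natl.
have S0 : (0 <= S)%E.
  by rewrite !adde_ge0 ?poweR_ge0// sume_ge0// => *; exact: poweR_ge0.
apply: (@le_trans _ _ (((m.+2%:R * (D * N) `^ p)%:E) `^ p^-1)%E).
  apply: gt0_ler_poweR SB; first by rewrite invr_ge0 ltW.
    by rewrite in_itv/= leey S0.
  by rewrite in_itv/= leey andbT lee_fin mulr_ge0// powR_ge0.
rewrite poweR_EFin lee_fin powRM ?powR_ge0// -powRrM mulfV ?gt_eqF// powRr1 ?mulr_ge0//.
by rewrite mulrA ler_wpM2r// lerDl.
Qed.

Lemma extension_ae A u : A `<=` `[a + 3 * d, b - 3 * d]%classic ->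
  extension u = u %[ae mu in A].
Proof.
move=> AO; apply: aeW => x /AO; rewrite /= in_itv/= => /andP[h1 h2].
rewrite /extension /chi0 /= cutoff_eq1 ?mul1r//.
by apply/andP; split; lra.
Qed.

Lemma extension_support u :
  ess_support (extension u) `<=` `[a + 2 * d, b - 2 * d]%classic.
Proof.
move=> x xS; apply: contrapT => xK; apply: xS.
exists (~` `[a + 2 * d, b - 2 * d]%classic) => //; split.
  exact/closed_openC/itv_closed.
apply: aeW => y; rewrite /= in_itv/= => /negP yK.
by rewrite /extension /= chi_vanishes ?mul0r.
Qed.

End Extension.

(** * Recovering the interval and the scale from the compact set *)

Section Encoding.
Variable R : realType.
Implicit Types a b d : R.

(* The isolated point makes [a], [b] and [d] recoverable from the set, so that
   a constant depending on [a], [b] and [d] is a function of the set. *)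
Definition marked_segment a b d : set R :=
  [set a + d] `|` `[a + 2 * d, b - 2 * d]%classic.

(** The least point [a + d], the greatest point [b - 2 d] and the second least point [a + 2 d] are
    read off from the set, and these three numbers determine [a], [b] and [d]. *)
Lemma marked_segment_inj a b d a' b' d' :
  0 < d -> a + 3 * d <= b - 3 * d -> 0 < d' -> a' + 3 * d' <= b' - 3 * d' ->
  marked_segment a b d = marked_segment a' b' d' -> [/\ a = a', b = b' & d = d'].
Proof.
have half (x y e x' y' e' : R) : 0 < e -> x + 3 * e <= y - 3 * e ->
    0 < e' -> x' + 3 * e' <= y' - 3 * e' ->
    marked_segment x y e `<=` marked_segment x' y' e' ->
    x' + e' <= x + e /\ y - 2 * e <= y' - 2 * e'.
  move=> e0 xy e0' xy' sub; split.
    have [/= ->//|/=] := sub (x + e) (or_introl erefl).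
    by rewrite in_itv/= => /andP[h _]; lra.
  have [|/= ->|/=] := sub (y - 2 * e); last 2 first.
  - by lra.
  - by rewrite in_itv/= => /andP[_].
  - by right; rewrite /= in_itv/=; apply/andP; split; lra.
move=> d0 ab d0' ab' E.
have sub1 : marked_segment a b d `<=` marked_segment a' b' d' by rewrite E.
have sub2 : marked_segment a' b' d' `<=` marked_segment a b d by rewrite E.
have [h1 h2] := half _ _ _ _ _ _ d0 ab d0' ab' sub1.
have [h3 h4] := half _ _ _ _ _ _ d0' ab' d0 ab sub2.
(* The point [a + 2 d] lies in the other set and cannot be its isolated point, as [a' + d' = a + d]
   is smaller. *)
have h5 : a' + 2 * d' <= a + 2 * d.
  have [|/= h|/=] := sub1 (a + 2 * d); last 2 first.
  - by lra.
  - by rewrite in_itv/= => /andP[].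
  - by right; rewrite /= in_itv/=; apply/andP; split; lra.
have h6 : a + 2 * d <= a' + 2 * d'.
  have [|/= h|/=] := sub2 (a' + 2 * d'); last 2 first.
  - by lra.
  - by rewrite in_itv/= => /andP[].
  - by right; rewrite /= in_itv/=; apply/andP; split; lra.
by split; lra.
Qed.

End Encoding.

Unset Implicit Arguments.
Local Open Scope ring_scope.

Theorem theorem4p9 (R : realType) (s : side) :
  exists C : R -> R -> set R -> R,
    (forall alpha p K, 0 < C alpha p K) /\
    forall (a b alpha p : R) (Omega' : set R),
      a < b -> 0 < alpha -> 1 <= p ->
      compactly_contained Omega' `]a, b[%classic ->
      exists (K : set R) (E : (R -> R) -> (R -> R)),
        [/\ compact K,
            K `<=` `]a, b[%classic,
            class_mapping `]a, b[%classic setT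
              (frac_sobolev s alpha p `]a, b[%classic)
              (frac_sobolev s alpha p setT) E
          & forall u, frac_sobolev s alpha p `]a, b[%classic u ->
              [/\ E u = u %[ae leb R in Omega'],
                  ess_support (E u) `<=` K
                & (frac_sobolev_norm s alpha p setT (E u) <=
                   (C alpha p K)%:E *
                   frac_sobolev_norm s alpha p `]a, b[%classic u)%E]].
Proof.
(* The constant is chosen for each triple [(alpha, p, K)]: if [K] is a marked segment with
   admissible parameters, these are unique and give the constant; otherwise it is 1. *)
have /choice [C hC] : forall t : R * R * set R, exists C : R, 0 < C /\
    forall a b d, 0 < t.1.1 -> 1 <= t.1.2 -> 0 < d -> a + 3 * d <= b - 3 * d ->
    t.2 = marked_segment a b d ->
    forall u, frac_sobolev s t.1.1 t.1.2 `]a, b[%classic u ->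
      (frac_sobolev_norm s t.1.1 t.1.2 setT (extension a b d u) <=
       C%:E * frac_sobolev_norm s t.1.1 t.1.2 `]a, b[%classic u)%E.
  move=> [[alpha p] K] /=.
  have [[a [b [d [a0 p1 d0 abd KE]]]]|no] := pselect (exists a b d,
      [/\ 0 < alpha, 1 <= p, 0 < d, a + 3 * d <= b - 3 * d & K = marked_segment a b d]).
    have [C C0 hC] := extension_norm_bound s a0 p1 d0 abd.
    exists C; split=> // a' b' d' _ _ d0' abd' KE'.
    rewrite KE in KE'.
    by have [<- <- <-] := marked_segment_inj d0 abd d0' abd' KE'.
  exists 1; split=> // a b d a0 p1 d0 abd KE; exfalso; apply: no.
  by exists a, b, d.
exists (fun alpha p K => C (alpha, p, K)); split.
  by move=> alpha p K; have [] := hC (alpha, p, K).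
move=> a b alpha p Omega' ab a0 p1 [cO /(compact_sub_itv ab cO)].
move=> [l [r [al lr rb Olr]]].
(* A quarter of the gap, so that [[l, r]], hence [Omega'], lies in [[a + 3 d, b - 3 d]], where the
   cutoff is 1. *)
pose d := Num.min (l - a) (b - r) / 4.
have [d0 hl hr] : [/\ 0 < d, 4 * d <= l - a & 4 * d <= b - r].
  have -> : 4 * d = Num.min (l - a) (b - r) by rewrite /d mulrC divfK.
  rewrite divr_gt0 ?lt_min ?subr_gt0 ?al//; split=> //; rewrite ge_min ?lexx ?orbT//.
have abd : a + 3 * d <= b - 3 * d by lra.
exists (marked_segment a b d), (extension a b d); split.
- by apply: compactU; [exact: compact_set1|exact: segment_compact].
- move=> x [/= ->|/=]; rewrite !in_itv/=; first by apply/andP; split; lra.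
  by move=> /andP[? ?]; apply/andP; split; lra.
- exact: extension_class_mapping.
move=> u fu; split.
- apply: extension_ae => // x /subset_closure /Olr; rewrite /= !in_itv/= => /andP[? ?].
  by apply/andP; split; lra.
- by apply: subset_trans (extension_support d0 (u := u)) _ => x ?; right.
- by have [_] := hC (alpha, p, marked_segment a b d); apply.
Qed.
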